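(* Let $\mathcal G=(M,w^-,w^+)$ be a conditioned weighted graph, with $M$ of order $N$. Let $\pi$ be the stationary measure on $\{1,\dots,N\}$ associated with the limit weighted measure of $\mathcal G$. Let $f:\{1,\dots,N\}\to\mathbb R$ be a function and $\gamma_f=\sum_{j=1}^N\pi(j)f(j)$. Then there exists a non-negative real $\sigma^2$ such that the following convergence in law with respect to $\mu_k$ toward a Normal law holds: $$\frac1{\sqrt{k+1}}\bigl(S_kf-(k+1)\gamma_f\bigr)\xrightarrow[k\to\infty]{\mathcal L}\mathcal N(0,\sigma^2).$$ Moreover, $\sigma^2=0$ if and only if there exists a function $g:\{1,\dots,N\}\to\mathbb R$ such that $f(i)=\gamma_f+g(i)-g(j)$ whenever $M_{i,j}>0$ and $i,j\in\operatorname{supp}\pi$.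
   Context: A conditioned weighted graph is a triple $\mathcal G=(M,w^-,w^+)$ where $M$ is a non-negative real $N\times N$ matrix, $N>1$, and $w^-,w^+:\{1,\dots,N\}\to[0,\infty)$ (identified with a row vector and a column vector respectively), such that: (i) $M$ has a unique eigenvalue $\lambda$ of maximal modulus, and it is simple (then $\lambda$ is real and positive, and there exist non-negative left (row) and right (column) $\lambda$-eigenvectors $\ell$, $r$ with $\ell\cdot r=1$); (ii) $w^-\cdot r>0$ and $\ell\cdot w^+>0$. A path of length $k\geq0$ is a sequence $(x_0,\dots,x_k)$ of indices with $M_{x_i,x_{i+1}}>0$ for $0\leq i<k$; its weight is $w(x)=w^-(x_0)M_{x_0,x_1}\cdots M_{x_{k-1},x_k}w^+(x_k)$. $G_k$ is the set of paths of length $k$, and the weighted distribution $\mu_k$ on $G_k$ is $\mu_k(z)=w(z)/Z_k$, $Z_k=\sum_{z\in G_k}w(z)$, well defined ($Z_k>0$) for all $k$ large enough. As $k\to\infty$, the $\mu_k$ converge weakly (on the compact space of finite or infinite paths) to a probability measure on infinite paths, called the limit weighted measure, under which the successive vertices form a Markov chain with transition matrix $P_{i,j}=\lambda^{-1}M_{i,j}r(j)/r(i)$ on states with $r(i)\neq0$; the associated stationary measure is $\pi(i)=\ell(i)r(i)$, $1\leq i\leq N$. For a path $z=(x_0,\dots,x_k)$, the ergodic sum is $S_kf(z)=\sum_{i=0}^kf(x_i)$, viewed as a random variable on $(G_k,\mu_k)$. $\mathcal N(0,0)$ denotes the Dirac measure at $0$. *)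

(* Defs.v *)
From HB Require Import structures.
From mathcomp Require Import all_boot all_order all_algebra.
From mathcomp Require Import complex.
From mathcomp Require Import all_classical all_reals all_analysis.

Set Implicit Arguments.
Unset Strict Implicit.
Unset Printing Implicit Defensive.

Import Order.TTheory GRing.Theory Num.Theory.
Import numFieldNormedType.Exports.

Local Open Scope classical_set_scope.
Local Open Scope ring_scope.

Section ConditionedWeightedGraph.
Variables (R : realType) (N : nat).

Local Notation toC := (map_mx (real_complex R)).

(* The spectrum is taken over the complex numbers; [mup] of the characteristic
   polynomial is the algebraic multiplicity. *)
Definition simple_dominant_eigenvalue (M : 'M[R]_N) (lam : R[i]) : Prop :=
  [/\ eigenvalue (toC M) lam,
      forall mu : R[i], eigenvalue (toC M) mu -> mu != lam -> `|mu| < `|lam|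
    & mup lam (char_poly (toC M)) = 1%N].

Record perron_vectors (M : 'M[R]_N) (lam : R[i])
    (l : 'rV[R]_N) (r : 'cV[R]_N) : Prop := PerronVectors {
  left_ge0 : forall i, 0 <= l 0 i;
  right_ge0 : forall i, 0 <= r i 0;
  left_eigen : toC l *m toC M = lam *: toC l;
  right_eigen : toC M *m toC r = lam *: toC r;
  left_right1 : (l *m r) 0 0 = 1
}.

(* By Perron-Frobenius, [lam], [l] and [r] below exist as soon as [M] has a
   simple dominant eigenvalue; [lam] is unique, and [l], [r] are unique up to
   replacement by [c *: l], [c^-1 *: r] with [0 < c]. *)
Record cond_weighted_graph := CondWeightedGraph {
  cwg_mat : 'M[R]_N;
  cwg_init : 'rV[R]_N;
  cwg_final : 'cV[R]_N;
  cwg_order : (1 < N)%N;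
  cwg_mat_ge0 : forall i j, 0 <= cwg_mat i j;
  cwg_init_ge0 : forall i, 0 <= cwg_init 0 i;
  cwg_final_ge0 : forall i, 0 <= cwg_final i 0;
  cwg_perron : exists (lam : R[i]) (l : 'rV[R]_N) (r : 'cV[R]_N),
    [/\ simple_dominant_eigenvalue cwg_mat lam,
        perron_vectors cwg_mat lam l r,
        0 < (cwg_init *m r) 0 0
      & 0 < (l *m cwg_final) 0 0]
}.

Variable G : cond_weighted_graph.

(* The product [l i * r i] does not depend on the normalization of [l], [r],
   so exactly one [p] satisfies this. *)
Definition stationary_measure (p : 'I_N -> R) : Prop :=
  exists (lam : R[i]) (l : 'rV[R]_N) (r : 'cV[R]_N),
    [/\ simple_dominant_eigenvalue (cwg_mat G) lam,
        perron_vectors (cwg_mat G) lam l r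
      & forall i, p i = l 0 i * r i 0].

Definition is_path k (x : (k.+1).-tuple 'I_N) : bool :=
  [forall i : 'I_k, 0 < cwg_mat G (tnth x (inord i)) (tnth x (inord i.+1))].

Definition gpath k : finType := {x : (k.+1).-tuple 'I_N | is_path x}.

Definition vertex k (z : gpath k) (i : 'I_k.+1) : 'I_N := tnth (val z) i.

Definition weight k (z : gpath k) : R :=
  cwg_init G 0 (vertex z ord0)
  * (\prod_(i < k) cwg_mat G (vertex z (inord i)) (vertex z (inord i.+1)))
  * cwg_final G (vertex z ord_max) 0.

Definition partition_sum k : R := \sum_(z : gpath k) weight z.

(* Meaningful only when [partition_sum k != 0], which holds for all large [k]. *)
Definition weighted_distr k (z : gpath k) : R := weight z / partition_sum k.

Definition ergodic_sum (f : 'I_N -> R) k (z : gpath k) : R :=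
  \sum_(i < k.+1) f (vertex z i).

End ConditionedWeightedGraph.

Section ConvergenceInLaw.
Variable R : realType.

(* [normal_prob] is parameterized by the standard deviation, and
   [normal_prob m 0] is not the Dirac measure at [m]. *)
Definition normal_law (m s2 : R) : probability (measurableTypeR R) R :=
  if s2 == 0 then (\d_(m : measurableTypeR R) : probability _ R)
  else (normal_prob m (Num.sqrt s2) : probability _ R).

(* Weak convergence to [nu] of the laws of the random variables [X k], defined
   on the finite spaces [T k] with probability mass functions [p k]. *)
Definition cvg_in_law (T : nat -> finType) (p X : forall k, T k -> R)
    (nu : probability (measurableTypeR R) R) : Prop :=
  forall h : R -> R, continuous h -> bounded_fun h ->
    (\sum_(x : T k) p k x * h (X k x))%:E @[k --> \oo]
      --> (\int[nu]_x (h x)%:E)%E.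

End ConvergenceInLaw.

(* Main.v *)
Require Import Defs.
From mathcomp Require Import all_boot all_order all_algebra.
From mathcomp Require Import complex.
From mathcomp Require Import all_classical all_reals all_analysis.
From mathcomp Require Import measurable_realfun.
From mathcomp Require Import ring lra.

(** The limit theorem is proved by following a Gaussian test function through
    the transfer operator of the graph, where it obeys the heat equation up to
    small errors.

    Let A = M / lambda, with eigenvectors l and r. The powers of A converge to
    the rank-one matrix r l (perron_power_cvg): subtracting r l from A moves the
    eigenvalue 1 to 0 and keeps the others, which have modulus < 1, so that the
    powers of the difference vanish. Hence every equation a = y + A a with
    l y = 0 is solvable (poisson_solvable).

    Replace f by f - gamma. Summing a function of the rescaled ergodic sum over
    the paths of length k amounts to applying k times the operator
    T F (s, i) = sum_j A i j F (s + q f i, j), with q = (k + 1)^(-1/2)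
    (graph_sum_transfer). Let Phi v s be the Gaussian density of variance v; it
    solves the heat equation d/dv Phi = 1/2 d^2/ds^2 Phi. With first- and
    second-order correctors a and b, two solutions of Poisson equations, the
    function r Phi + q a Phi' + q^2 b Phi'' satisfies
      T [corrected Phi_v] = corrected Phi_(v + q^2 sigma^2) + O(q^3)
    uniformly in s (corrector_step): the terms of order q vanish by the choice
    of a, and those of order q^2 by the choice of b, whose Poisson equation is
    solvable exactly when sigma^2 has the right value. After k steps the
    variance has grown by k q^2 sigma^2, which tends to sigma^2, and the errors
    add up to O(q). The final weights w^+ differ from (l w^+) r by a vector that
    the powers of A send to 0, so they only contribute the factor l w^+
    (transfer_limit). Dividing by the partition function, the expectation of
    Phi_v (X_k - x) tends to Phi_(v + sigma^2) x, uniformly in x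
    (gaussian_test_cvg).

    This is convergence in law (cvg_in_law_gauss_kernel): a continuous function
    with compact support is uniformly close to its convolution with a narrow
    Gaussian, whose expectation is an integral of expectations of Gaussian test
    functions; tent functions then show that no mass escapes to infinity.

    Finally put e i j = l i * A i j * r j, the stationary law of an edge, and
    a = r g. Then sigma^2 is the sum of e i j (f i + g j - g i)^2, which is
    non-negative, and vanishes exactly when f is a coboundary along the edges of
    positive mass (edge_form_eq0). *)

Set Implicit Arguments.
Unset Strict Implicit.
Unset Printing Implicit Defensive.

Import Order.TTheory GRing.Theory Num.Theory.
Import numFieldNormedType.Exports.

Local Open Scope classical_set_scope.
Local Open Scope ring_scope.

(** * Powers of a matrix with a simple dominant eigenvalue *)

(** The matrix determinant lemma. The factor [z] clears the denominators of
    [\det (1 + z^-1 u v) = 1 + z^-1 v u], so that [z] may be the polynomial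
    ['X - a%:P] below. *)
Lemma det_scalar_add_rank1 (D : idomainType) n (z : D) (u : 'cV[D]_n) (v : 'rV[D]_n) :
  z != 0 -> \det (z%:M + u *m v) * z = z ^+ n * (z + (v *m u) 0 0).
Proof.
move=> z0; pose K : 'M[D]_(n + 1) := block_mx z%:M u (- v) 1%:M.
have <- : \det K = \det (z%:M + u *m v).
  rewrite -[LHS]mulr1 -[X in _ * X](_ : \det (block_mx 1%:M 0 v 1%:M : 'M[D]_(n + 1)) = _).
    rewrite -det_mulmx mulmx_block !mulmx1 !mul1mx !mulmx0 add0r addNr add0r.
    by rewrite det_ublock det1 mulr1.
  by rewrite det_lblock !det1 mulr1.
rewrite -[X in _ * X](_ : \det (block_mx 1%:M (- u) 0 z%:M : 'M[D]_(n + 1)) = _); last first.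
  by rewrite det_ublock det1 mul1r det_scalar1.
rewrite -det_mulmx mulmx_block !mulmx1 !mulmx0 !addr0 !mul1mx.
rewrite mul_scalar_mx scalerN mul_mx_scalar addNr det_lblock det_scalar.
by rewrite mulNmx mulmxN opprK [X in \det X]mx11_scalar det_scalar1 !mxE eqxx mulr1n addrC.
Qed.

(** Brauer's theorem: as [('X - A) r = ('X - a) r], one has
    [('X - a) ('X - A + r w) = ('X - A) ('X - a + r w)]; take determinants. *)
Lemma char_poly_deflation (F : fieldType) n (A : 'M[F]_n) (a : F)
    (r : 'cV[F]_n) (w : 'rV[F]_n) : A *m r = a *: r ->
  ('X - a%:P) * char_poly (A - r *m w) =
  ('X - a%:P + ((w *m r) 0 0)%:P) * char_poly A.
Proof.
move=> Ar; pose z := 'X - a%:P; pose pC := map_mx (@polyC F).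
have z0 : z != 0 by rewrite polyXsubC_eq0.
have e : char_poly_mx A *m (z%:M + pC _ _ r *m pC _ _ w) =
         z%:M *m char_poly_mx (A - r *m w).
  have CR : char_poly_mx A *m pC _ _ r = z *: pC _ _ r.
    by rewrite mulmxBl -map_mxM Ar mul_scalar_mx map_mxZ -scalerBl.
  rewrite mulmxDr mul_mx_scalar mulmxA CR -scalemxAl mul_scalar_mx -scalerDr.
  by rewrite /char_poly_mx map_mxB map_mxM opprB -addrA [- _ + _]addrC.
have := congr1 determinant e; rewrite !det_mulmx det_scalar => {}e.
have := det_scalar_add_rank1 (pC _ _ r) (pC _ _ w) z0 => d.
apply: (mulfI (expf_neq0 n z0)).
rewrite -/z mulrCA -[X in _ * X]e -/(char_poly A) mulrCA [z * _]mulrC d.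
rewrite mulrCA; congr (_ * _); rewrite mulrC; congr ((_ + _) * _).
by rewrite /pC -map_mxM mxE.
Qed.

(** Deflating a simple eigenvalue moves it to 0 and keeps all the others: compare
    the multiplicities of [a] in the two sides of Brauer's identity. *)
Lemma root_char_poly_deflation (F : fieldType) n (M : 'M[F]_n) (a : F)
    (r : 'cV[F]_n) (l : 'rV[F]_n) (mu : F) :
  a != 0 -> mup a (char_poly M) = 1%N -> M *m r = a *: r -> (l *m r) 0 0 = 1 ->
  root (char_poly (M - r *m (a *: l))) mu ->
  mu != a /\ (mu = 0 \/ root (char_poly M) mu).
Proof.
move=> a0 Ma Mr lr rB; set B := M - _ in rB.
have := char_poly_deflation (a *: l) Mr.
rewrite -/B -scalemxAl mxE lr mulr1 subrK => defl.
have cB0 : char_poly B != 0 by rewrite monic_neq0 // char_poly_monic.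
have cM0 : char_poly M != 0 by rewrite monic_neq0 // char_poly_monic.
have aB : ~~ root (char_poly B) a.
  rewrite -dvdp_XsubCl XsubC_dvd // -eqn0Ngt.
  have := congr1 (mup a) defl.
  rewrite !mupM ?polyXsubC_eq0 ?polyX_eq0 // Ma.
  rewrite -['X - _]expr1 mup_XsubCX eqxx [mup a 'X]mupNroot ?rootX //.
  by rewrite add1n add0n => -[->].
have mua : mu != a by apply: contraNneq aB => <-.
split=> //.
have : root ('X * char_poly M) mu by rewrite -defl rootM rB orbT.
by rewrite rootM rootX => /orP[/eqP|]; [left|right].
Qed.

Section PowerConvergence.
Variable R : realType.
Implicit Types (a b : R^nat) (rho : R).

(** The elementary substitute for a spectral radius formula: a linear recursion
    of ratio less than 1 with vanishing input has a vanishing solution. *)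
Lemma contraction_cvg0 a b rho : 0 <= rho < 1 -> (forall n, 0 <= a n) ->
  (forall n, a n.+1 <= rho * a n + b n) ->
  b @ \oo --> (0 : R) -> a @ \oo --> (0 : R).
Proof.
move=> /andP[rho0 rho1] a0 ab b0.
apply/cvgrPdist_le => e e0.
pose d := e / 2 * (1 - rho).
have d0 : 0 < d by rewrite mulr_gt0 ?divr_gt0 ?subr_gt0.
have [n0 _ bn] : \forall n \near \oo, `|b n| <= d.
  by move/cvgrPdist_le : b0 => /(_ _ d0); under eq_near do rewrite sub0r normrN.
have step m : a (n0 + m)%N <= rho ^+ m * a n0 + e / 2.
  elim: m => [|m IH]; first by rewrite addn0 expr0 mul1r lerDl divr_ge0 ?ltW.
  rewrite addnS; apply: (le_trans (ab _)).
  have := bn (n0 + m)%N (leq_addr _ _); rewrite ler_norml => /andP[_ h].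
  have := ler_wpM2l rho0 IH; rewrite mulrDr mulrA -exprS => h'.
  apply: (le_trans (lerD h' h)); rewrite -addrA lerD2l /d; nra.
have g0 : (fun m => rho ^+ m * a n0) @ \oo --> (0 : R).
  rewrite -[X in _ --> X](mul0r (a n0)); apply: cvgMl.
  by apply: cvg_expr; rewrite ger0_norm.
have [n1 _ gn] : \forall n \near \oo, `|rho ^+ n * a n0| <= e / 2.
  have e2 : 0 < e / 2 by rewrite divr_gt0.
  by move/cvgrPdist_le : g0 => /(_ _ e2); under eq_near do rewrite sub0r normrN.
exists (n0 + n1)%N => // n /= hn.
rewrite sub0r normrN ger0_norm //.
have nn : (n = n0 + (n - n0))%N by rewrite subnKC // (leq_trans _ hn) ?leq_addr.
rewrite nn; apply: (le_trans (step _)).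
have hn1 : (n1 <= n - n0)%N by rewrite leq_subRL ?(leq_trans _ hn) ?leq_addr.
have := gn (n - n0)%N hn1.
rewrite ler_norml => /andP[_ h]; rewrite -lerBrDr; lra.
Qed.

Local Notation nc := (@ComplexField.Normc.normc R).

Let ncE (z : R[i]) : `|z| = (nc z)%:C%C. Proof. by case: z. Qed.

Let nc_ge0 (z : R[i]) : 0 <= nc z. Proof. by case: z => x y; rewrite sqrtr_ge0. Qed.

Local Notation toC := (map_mx (real_complex R)).

Definition mxvanish m n (X : nat -> 'M[R[i]]_(m, n)) :=
  forall i j, (fun k => nc (X k i j)) @ \oo --> (0 : R).

(** The entries [x_k] of [C ^+ k *m Y] satisfy [x_(k+1) = mu x_k + y_k], where
    [y_k] are the entries that are assumed to vanish. *)
Lemma mxvanish_root n m (C : 'M[R[i]]_n.+1) (Y : 'M[R[i]]_(n.+1, m)) (mu : R[i]) :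
  `|mu| < 1 ->
  mxvanish (fun k => C ^+ k *m ((C - mu%:M) *m Y)) ->
  mxvanish (fun k => C ^+ k *m Y).
Proof.
move=> mu1 h i j; apply: (contraction_cvg0 (rho := nc mu)) (h i j).
- by rewrite nc_ge0 -ltcR -ncE.
- by move=> k; rewrite nc_ge0.
move=> k.
have -> : (C ^+ k.+1 *m Y) i j =
    mu * (C ^+ k *m Y) i j + (C ^+ k *m ((C - mu%:M) *m Y)) i j.
  rewrite mulmxBl mulmxBr mul_scalar_mx -scalemxAr mulmxA exprSr -mulmxE !mxE.
  by rewrite addrCA subrr addr0.
rewrite -ComplexField.Normc.normcM; exact: le_normcD.
Qed.

(** By Cayley-Hamilton the product of all [C - mu] is 0; its factors are removed
    one at a time by the previous lemma. *)
Lemma mxvanish_pow n (C : 'M[R[i]]_n.+1) :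
  (forall mu, root (char_poly C) mu -> `|mu| < 1) -> mxvanish (fun k => C ^+ k).
Proof.
move=> Cmu; have [rs] := closed_field_poly_normal (char_poly C).
rewrite (monicP (char_poly_monic C)) scale1r => E.
have rsmu : all (fun mu => `|mu| < 1) rs.
  by apply/allP => mu mus; apply: Cmu; rewrite E root_prod_XsubC.
have : horner_mx C (\prod_(z <- rs) ('X - z%:P)) = 0.
  by rewrite -E; exact: Cayley_Hamilton.
move=> h.
suff : mxvanish (fun k => C ^+ k *m (1%:M : 'M[R[i]]_n.+1)).
  by under [X in mxvanish X]eq_fun do rewrite mulmx1.
have : mxvanish (fun k => C ^+ k *m (horner_mx C (\prod_(z <- rs) ('X - z%:P)) *m 1%:M)).
  move=> i j; rewrite /= h mul0mx; under eq_fun do rewrite mulmx0 mxE Normc.normc0.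
  exact: cvg_cst.
move: (1%:M : 'M[R[i]]_n.+1) => Y; elim: rs rsmu Y {E h} => [|mu rs IH] /=.
  by move=> _ Y; rewrite big_nil rmorph1 mul1mx.
move=> /andP[mu1 rs1] Y; rewrite big_cons mulrC rmorphM /= -mulmxE -mulmxA.
by move/(IH rs1); rewrite rmorphB /= horner_mx_X horner_mx_C; exact: mxvanish_root.
Qed.

(** With [A = lam0^-1 *: M] and [E = r *m l], the matrix [D = A - E] satisfies
    [E D = 0] and [A ^+ k = E + D ^+ k] for [0 < k]; by deflation all its
    eigenvalues have modulus less than 1. *)
Theorem perron_power_cvg n (M : 'M[R]_n.+2) (lam : R[i]) l r :
  (forall i j, 0 <= M i j) -> simple_dominant_eigenvalue M lam -> perron_vectors M lam l r ->
  exists lam0 : R, [/\ lam = real_complex R lam0, 0 < lam0, M *m r = lam0 *: r, l *m M = lam0 *: l &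
    forall i j, (fun k => ((lam0^-1 *: M) ^+ k) i j) @ \oo --> (r i 0 * l 0 j)].
Proof.
move=> M0 [Elam Dlam Mlam] [l0 r0 El Er lr].
(* If 0 were dominant, it would be the only root of the characteristic
   polynomial, hence of multiplicity n + 2 > 1. *)
have lamne : lam != 0.
  apply/eqP => lam0; move: Mlam.
  have [rs] := closed_field_poly_normal (char_poly (toC M)).
  rewrite (monicP (char_poly_monic _)) scale1r => E.
  have rs0 : all (pred1 lam) rs.
    apply/allP => mu mus; apply/negPn/negP => mul.
    have : eigenvalue (toC M) mu by rewrite eigenvalue_root_char E root_prod_XsubC.
    by move=> /Dlam /(_ mul); rewrite lam0 normr0 normr_lt0.
  have srs : size rs = n.+2.
    have := size_char_poly (toC M); rewrite E size_prod_XsubC; by case.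
  by rewrite E mu_prod_XsubC; move: rs0; rewrite all_count => /eqP ->; rewrite srs.
have [i0 ri0] : exists i, r i 0 != 0.
  apply: contrapT => /forallNP H.
  move: lr; rewrite mxE big1 => [/esym/eqP|i _]; first by rewrite oner_eq0.
  by have /negP := H i; rewrite negbK => /eqP ->; rewrite mulr0.
pose lam0 := (M *m r) i0 0 / r i0 0.
have lamE : lam = real_complex R lam0.
  have := congr1 (fun X : 'cV[R[i]]_n.+2 => X i0 0) Er.
  rewrite -map_mxM !mxE => e.
  rewrite /lam0 rmorphM fmorphV /= [X in (X%:C)%C * _]mxE e mulfK //.
  by rewrite (inj_eq (@complexI R) _ 0).
have lam00 : 0 < lam0.
  rewrite lt_neqAle; apply/andP; split.
    by apply: contraNneq lamne => e; rewrite lamE -e.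
  by rewrite divr_ge0 // mxE sumr_ge0 // => j _; rewrite mulr_ge0.
have Er' : M *m r = lam0 *: r.
  apply: (@map_mx_inj _ _ (real_complex R)); rewrite map_mxM map_mxZ /=.
  by rewrite -lamE.
have El' : l *m M = lam0 *: l.
  apply: (@map_mx_inj _ _ (real_complex R)); rewrite map_mxM map_mxZ /=.
  by rewrite -lamE.
exists lam0; split => //.
pose A := lam0^-1 *: M; pose E := r *m l; pose D := A - E.
have Ar : A *m r = r by rewrite -scalemxAl Er' scalerA mulVf ?gt_eqF// scale1r.
have lA : l *m A = l by rewrite -scalemxAr El' scalerA mulVf ?gt_eqF// scale1r.
have lr1 : l *m r = 1%:M by rewrite [LHS]mx11_scalar lr.
have EE : E * E = E by rewrite -mulmxE mulmxA -[r *m l *m r]mulmxA lr1 mulmx1.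
have AE : A * E = E by rewrite -mulmxE mulmxA Ar.
have ED : E * D = 0 by rewrite mulrBr EE -mulmxE -mulmxA lA subrr.
have Dpow k : A ^+ k.+1 = E + D ^+ k.+1.
  elim: k => [|k IH]; first by rewrite !expr1 addrC subrK.
  rewrite exprS IH mulrDr AE; congr (_ + _).
  by rewrite -[A](subrK E) mulrDl -/D -exprS [D ^+ k.+1]exprS mulrA ED mul0r addr0.
have rootD mu : root (char_poly (toC D)) mu -> `|mu| < 1.
  rewrite -eigenvalue_root_char => /eigenvalueP[v vD vne].
  pose B := toC M - toC r *m (lam *: toC l).
  have DB : toC D = lam^-1 *: B.
    rewrite /D /A /E /B map_mxB map_mxZ map_mxM fmorphV /= -lamE.
    by rewrite scalerBr -scalemxAr scalerA mulVf // scale1r.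
  have vB : v *m B = (lam * mu) *: v.
    by rewrite -scalerA -vD DB -scalemxAr scalerA mulfV // scale1r.
  have rB : root (char_poly B) (lam * mu).
    by rewrite -eigenvalue_root_char; apply/eigenvalueP; exists v.
  have lrC : (toC l *m toC r) 0 0 = 1 by rewrite -map_mxM mxE lr.
  have [nl [/eqP|]] := root_char_poly_deflation lamne Mlam Er lrC rB.
    by rewrite mulf_eq0 (negPf lamne) /= => /eqP ->; rewrite normr0 ltr01.
  rewrite -eigenvalue_root_char => /Dlam /(_ nl).
  by rewrite normrM -ltr_pdivlMl ?normr_gt0 // mulVf // normr_eq0.
have := mxvanish_pow rootD => van i j.
have -> : r i 0 * l 0 j = E i j by rewrite mxE big_ord1.
rewrite -cvg_shiftS /=.
have -> : (fun k => (A ^+ k.+1) i j) = (fun k => E i j + (D ^+ k.+1) i j).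
  by apply/funext => k; rewrite Dpow mxE.
apply/cvgrPdist_le => e e0.
have := van i j; rewrite -cvg_shiftS => /cvgrPdist_le /(_ _ e0) /=.
apply: filterS => k; rewrite sub0r normrN opprD addNKr normrN.
by rewrite -rmorphXn /= mxE /= expr0n addr0 sqrtr_sqr normr_id.
Qed.
End PowerConvergence.

(** * Matrices whose powers converge to a rank-one matrix *)

Lemma cvg_sum_seq (R : realType) (I : Type) (s : seq I) (F : I -> R^nat) (a : I -> R) :
  (forall i, F i @ \oo --> a i) ->
  (fun k => \sum_(i <- s) F i k) @ \oo --> \sum_(i <- s) a i.
Proof.
move=> Fa; elim: s => [|i s IH].
  by rewrite big_nil; under eq_fun do rewrite big_nil; exact: cvg_cst.
by rewrite big_cons; under eq_fun do rewrite big_cons; exact: cvgD.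
Qed.

Section RankOneLimit.
Variables (R : realType) (n : nat) (A : 'M[R]_n.+1).
Variables (l : 'rV[R]_n.+1) (r : 'cV[R]_n.+1).
Hypotheses (Ar : A *m r = r) (lA : l *m A = l) (lr1 : (l *m r) 0 0 = 1).
Hypothesis powA : forall i j, (fun k => (A ^+ k) i j) @ \oo --> (r i 0 * l 0 j).
Implicit Types x y : 'cV[R]_n.+1.

Lemma power_vec_cvg x i :
  (fun k => (A ^+ k *m x) i 0) @ \oo --> (r i 0 * (l *m x) 0 0).
Proof.
have -> : (fun k => (A ^+ k *m x) i 0) = (fun k => \sum_j (A ^+ k) i j * x j 0).
  by apply/funext => k; rewrite mxE.
have -> : r i 0 * (l *m x) 0 0 = \sum_j r i 0 * l 0 j * x j 0.
  by rewrite mxE mulr_sumr; apply: eq_bigr => j _; rewrite mulrA.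
apply: (@cvg_sum_seq _ _ _ (fun j k => (A ^+ k) i j * x j 0)) => j.
by apply: cvgM; [exact: powA|exact: cvg_cst].
Qed.

Lemma fixed_vecE x : A *m x = x -> x = (l *m x) 0 0 *: r.
Proof.
move=> Ax; have powx k : A ^+ k *m x = x.
  by elim: k => [|k IH]; rewrite ?expr0 ?mul1mx // exprSr -mulmxE -mulmxA Ax.
apply/colP => i; rewrite mxE mulrC.
have := @power_vec_cvg x i; under eq_fun do rewrite powx.
by move=> /cvg_lim <- //; rewrite lim_cst.
Qed.

(** [1 - A + r l] is invertible: a vector [u] of its kernel has [l u = 0], since
    [l (1 - A + r l) = l], hence is fixed by [A], hence is a multiple of [r].
    The same identity gives [l a = l y = 0] for the solution [a]. *)
Lemma poisson_solvable y : (l *m y) 0 0 = 0 ->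
  exists2 a, a = y + A *m a & (l *m a) 0 0 = 0.
Proof.
move=> ly; pose D := 1%:M - A + r *m l.
have lr : l *m r = 1%:M by rewrite [LHS]mx11_scalar lr1.
have lD : l *m D = l by rewrite mulmxDr mulmxBr mulmx1 lA subrr add0r mulmxA lr mul1mx.
have uD : D \in unitmx.
  rewrite -unitmx_tr -row_free_unit -kermx_eq0; apply/eqP/row_matrixP => i.
  rewrite row0; set u := row i _.
  have uD : u *m D^T = 0 by apply/sub_kermxP; exact: row_sub.
  have Du : D *m u^T = 0 by rewrite -[LHS]trmxK trmx_mul trmxK uD trmx0.
  have lu : l *m u^T = 0 by rewrite -lD -mulmxA Du mulmx0.
  have Au : A *m u^T = u^T.
    move: Du; rewrite mulmxDl mulmxBl mul1mx -mulmxA lu mulmx0 addr0.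
    by move/eqP; rewrite subr_eq0 => /eqP.
  by rewrite -[LHS]trmxK (fixed_vecE Au) lu mxE scale0r trmx0.
pose a := invmx D *m y.
have Da : D *m a = y by rewrite /a mulKVmx.
have la : l *m a = l *m y by rewrite -{1}lD -mulmxA Da.
exists a; last by rewrite la.
have l0 : l *m a = 0 by apply/matrixP => i j; rewrite !ord1 la ly mxE.
move: Da; rewrite mulmxDl mulmxBl mul1mx -mulmxA l0 mulmx0 addr0 => <-.
by rewrite subrK.
Qed.

Lemma power_bounded : exists B, forall k i, \sum_j (A ^+ k) i j <= B.
Proof.
have h i : exists2 B, 0 <= B & forall k, \sum_j (A ^+ k) i j <= B.
  have := @power_vec_cvg (const_mx 1) i => /cvgP /cvg_seq_bounded [M [Mr hM]].
  exists (`|M| + 1) => [|k]; first by rewrite addr_ge0.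
  have MM : M < `|M| + 1 by rewrite (le_lt_trans (ler_norm _)) // ltrDl.
  have : `|(A ^+ k *m const_mx 1) i 0| <= `|M| + 1 := hM _ MM k I.
  move/(le_trans (ler_norm _)); rewrite mxE.
  by under eq_bigr do rewrite mxE mulr1.
pose b i := s2val (cid2 (h i)).
exists (\sum_i b i) => k i; rewrite [X in _ <= X](bigD1 i) //=.
apply: le_trans (s2valP' (cid2 (h i)) k) _; rewrite lerDl sumr_ge0 // => j _.
exact: (s2valP (cid2 (h j))).
Qed.

End RankOneLimit.

(** * The heat flow of Gaussian densities *)

Section GaussianFlow.
Variable R : realType.
Implicit Types (v s t d C : R) (n m : nat).

(** The mean value inequality in the form that is iterated to get Taylor
    expansions: a bound of order [n] on the derivative gives one of order [n.+1]
    on the increment. Only the points between 0 and [d] matter, as variances have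
    to stay positive. *)
Lemma increment_le (F F' : R -> R) d C n : F 0 = 0 ->
  (forall t, 0 <= t * d -> `|t| <= `|d| ->
     is_derive t 1 F (F' t) /\ `|F' t| <= C * `|t| ^+ n) ->
  `|F d| <= C * `|d| ^+ n.+1.
Proof.
move=> F0 hF.
have C0 : 0 <= C * `|d| ^+ n.
  have [_] := hF d (sqr_ge0 d) (lexx _); exact: le_trans.
have step c : 0 <= c * d -> `|c| <= `|d| -> `|F' c| * `|d| <= C * `|d| ^+ n.+1.
  move=> cd0 cd; rewrite exprSr mulrA ler_wpM2r //.
  have [_ h] := hF c cd0 cd; apply: (le_trans h).
  have [d0|d0] := eqVneq d 0.
    move: cd; rewrite d0 normr0 normr_le0 => /eqP ->; by rewrite normr0.
  have C1 : 0 <= C.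
    by move: C0; rewrite pmulr_lge0 // exprn_gt0 // normr_gt0.
  by rewrite ler_wpM2l // lerXn2r ?nnegrE.
have [d0|d0|d0] := ltgtP d 0.
- have [c||c] := @MVT R F F' d 0 d0.
  + rewrite in_itv /= => /andP[dc c0].
    apply: (proj1 (hF c _ _)); first by rewrite nmulr_lge0 ?ltW.
    by rewrite !ltr0_norm // lerN2 ltW.
  + apply: derivable_within_continuous => x; rewrite in_itv /= => /andP[dx x0].
    have [||D _] := hF x; first by rewrite nmulr_lge0.
      by rewrite ler0_norm // ltr0_norm // lerN2.
    exact: ex_derive.
  + rewrite in_itv /= => /andP[dc c0]; rewrite F0 sub0r sub0r => e.
    rewrite -normrN e normrM normrN; apply: step.
      by rewrite nmulr_lge0 // ltW.
    by rewrite !ltr0_norm // lerN2 ltW.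
- have [c||c] := @MVT R F F' 0 d d0.
  + rewrite in_itv /= => /andP[c0 cd].
    apply: (proj1 (hF c _ _)); first by rewrite mulr_ge0 ?ltW.
    by rewrite !gtr0_norm // ltW.
  + apply: derivable_within_continuous => x; rewrite in_itv /= => /andP[x0 xd].
    have [||D _] := hF x; first by rewrite mulr_ge0 // ltW.
      by rewrite ger0_norm // gtr0_norm.
    exact: ex_derive.
  + rewrite in_itv /= => /andP[c0 cd]; rewrite F0 !subr0 => e.
    rewrite e normrM; apply: step.
      by rewrite mulr_ge0 // ltW.
    by rewrite !gtr0_norm // ltW.
- by rewrite d0 F0 normr0 exprS mul0r mulr0.
Qed.

Lemma is_derive_mul (f g : R -> R) t (a b : R) :
  is_derive t 1 f a -> is_derive t 1 g b ->
  is_derive t 1 (fun x => f x * g x) (a * g t + f t * b).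
Proof.
move=> fa gb; have := is_deriveM fa gb.
by rewrite /GRing.scale /= addrC [g t * a]mulrC.
Qed.

Lemma is_derive_sub (f g : R -> R) t (a b : R) :
  is_derive t 1 f a -> is_derive t 1 g b ->
  is_derive t 1 (fun x => f x - g x) (a - b).
Proof. exact: is_deriveB. Qed.

Lemma is_derive_exprn (f : R -> R) n t (a : R) :
  is_derive t 1 f a -> is_derive t 1 (fun x => f x ^+ n) (n%:R * f t ^+ n.-1 * a).
Proof. by move=> fa; have := is_deriveX n fa; rewrite exprfctE. Qed.

Lemma is_derive_exp_comp (f : R -> R) t (a : R) :
  is_derive t 1 f a -> is_derive t 1 (fun x => expR (f x)) (expR (f t) * a).
Proof. by move=> fa; apply: is_derive1_comp. Qed.

Lemma is_derive_translate s t : is_derive t 1 (fun x => s + x) (1 : R).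
Proof.
have := @is_deriveD R _ _ (cst s) id t 1 0 1 (is_derive_cst _ _ _) (is_derive_id _ _).
by rewrite add0r.
Qed.

(** The monomials [s^n v^-m] times the Gaussian [v^(-1/2) exp (- s^2 / 2v)]: a
    family closed under the derivatives in [s] and in [v], and bounded when [v]
    stays in a compact subset of the positive half-line. *)
Definition gauss_mono n m v s : R :=
  s ^+ n * (v^-1 ^+ m * ((Num.sqrt v)^-1 * expR (s ^+ 2 * (- 2^-1 * v^-1)))).

Lemma is_derive_gauss_mono_space n m v s t : v != 0 ->
  is_derive t 1 (fun t => gauss_mono n m v (s + t))
    (n%:R * gauss_mono n.-1 m v (s + t) - gauss_mono n.+1 m.+1 v (s + t)).
Proof.
move=> v0; rewrite /gauss_mono.
have h := is_derive_translate s t.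
have hX := is_derive_exprn n h.
have hE := is_derive_exp_comp
  (is_derive_mul (is_derive_exprn 2 h) (is_derive_cst (- 2^-1 * v^-1 : R) t 1)).
have hC := is_derive_cst (v^-1 ^+ m) t (1 : R).
have hC' := is_derive_cst (Num.sqrt v)^-1 t (1 : R).
apply: (is_derive_eq (is_derive_mul hX (is_derive_mul hC (is_derive_mul hC' hE)))).
rewrite /cst /= (exprS (s + t) n) (exprS v^-1 m) expr1; move: (Num.sqrt v)^-1 => c; field.
exact: v0.
Qed.

Lemma is_derive_gauss_mono_time n m v s t : 0 < v + t ->
  is_derive t 1 (fun t => gauss_mono n m (v + t) s)
    (- (m%:R + 2^-1) * gauss_mono n m.+1 (v + t) s
     + 2^-1 * gauss_mono n.+2 m.+2 (v + t) s).
Proof.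
move=> vt; rewrite /gauss_mono.
have vt0 : v + t != 0 by rewrite gt_eqF.
have s0 : Num.sqrt (v + t) != 0 by rewrite gt_eqF // sqrtr_gt0.
have h := is_derive_translate v t.
have hV := is_deriveV vt0 h.
have hS := @is_deriveV R (Num.sqrt \o +%R v) t _ 1 s0 (is_derive1_comp (is_derive1_sqrt vt) h).
have hE := is_derive_exp_comp
  (is_derive_mul (is_derive_cst (s ^+ 2) t (1 : R)) (is_derive_mul (is_derive_cst (- 2^-1 : R) t (1 : R)) hV)).
have hC := is_derive_cst (s ^+ n) t (1 : R).
apply: (is_derive_eq
  (is_derive_mul hC (is_derive_mul (is_derive_exprn m hV) (is_derive_mul hS hE)))).
rewrite /cst /GRing.scale /=.
have em : m%:R * (v + t)^-1 ^+ m.-1 * - (v + t) ^- 2 = - m%:R * (v + t)^-1 ^+ m.+1.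
  case: (m) => [|k]; first by rewrite !mulNr !mul0r oppr0.
  by rewrite -exprVn mulrN mulNr -mulrA -exprD addn2.
rewrite !mulr1 em !(exprS (v + t)^-1) !(exprS s) -exprVn.
move: (sqr_sqrtr (ltW vt)); move: (Num.sqrt (v + t)) s0 => w w0 <-.
by field.
Qed.

Lemma gauss_mono_bounded n m eps V : 0 < eps -> exists2 K, 0 <= K &
  forall v s, eps <= v <= V -> `|gauss_mono n m v s| <= K.
Proof.
move=> e0.
exists ((1 + (2 * `|V|) ^+ n * n`!%:R) * (eps^-1 ^+ m * (Num.sqrt eps)^-1)).
  by rewrite mulr_ge0 // ?addr_ge0 ?mulr_ge0 ?exprn_ge0 ?invr_ge0 ?sqrtr_ge0 ?ler0n ?ltW // mulr_ge0.
move=> v s /andP[ev vV].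
have v0 : 0 < v by exact: lt_le_trans ev.
rewrite /gauss_mono; set x := s ^+ 2 / (2 * v).
have x0 : 0 <= x by rewrite divr_ge0 ?sqr_ge0 // mulr_ge0 // ltW.
have -> : s ^+ 2 * (- 2^-1 * v^-1) = - x by rewrite /x invfM mulNr mulrN.
rewrite [_ * (_ * expR _)]mulrA [_ ^+ n * (_ * _)]mulrCA mulrC !normrM.
apply: ler_pM => //.
  (* [s ^+ 2 = 2 v x] turns the power of [s] into one of [x], which the
     exponential absorbs. *)
  have sn : `|s ^+ n| <= 1 + (2 * v * x) ^+ n.
    have -> : 2 * v * x = s ^+ 2 by rewrite mulrCA mulfV ?mulr1 // mulf_neq0 ?gt_eqF.
    rewrite -exprM mulnC exprM -(real_normK (num_real (s ^+ n))).
    have := normr_ge0 (s ^+ n); nra.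
  have xe : x ^+ n * expR (- x) <= n`!%:R.
    rewrite expRN ler_pdivrMr ?expR_gt0 //.
    case: n {sn} => [|n]; first by rewrite expr0 fact0 mul1r -expR0 ler_expR.
    rewrite mulrC -ler_pdivrMr ?ltr0n ?fact_gt0 //.
    by apply: le_trans (expR_ge1Dxn n x0); rewrite lerDr ler01.
  rewrite [`|expR _|]ger0_norm ?expR_ge0 //.
  apply: (le_trans (ler_wpM2r (expR_ge0 _) sn)).
  rewrite mulrDl mul1r exprMn -mulrA; apply: lerD.
    by rewrite -expR0 ler_expR oppr_le0.
  have v20 : 0 <= 2 * v by rewrite mulr_ge0 // ltW.
  apply: ler_pM xe; rewrite ?mulr_ge0 ?expR_ge0 ?exprn_ge0 //.
  apply: lerXn2r; rewrite ?nnegrE ?mulr_ge0 ?(ltW v0) //.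
  by rewrite ler_pM2l // (le_trans vV) // ler_norm.
have ev0 : 0 <= v^-1 by rewrite invr_ge0 ltW.
have e1 : v^-1 <= eps^-1 by rewrite lef_pV2.
rewrite -normrM ger0_norm ?mulr_ge0 ?exprn_ge0 ?invr_ge0 ?sqrtr_ge0 ?(ltW v0) //.
apply: ler_pM; rewrite ?exprn_ge0 ?invr_ge0 ?sqrtr_ge0 ?(ltW v0) //.
  by apply: lerXn2r; rewrite // ?nnegrE // (le_trans ev0).
by rewrite lef_pV2 ?posrE ?sqrtr_gt0 // ler_wsqrtr.
Qed.


(** The density of variance [v] up to the factor [(2 pi)^(-1/2)], and its first
    two derivatives in [s]. *)
Definition gauss_kernel v s := gauss_mono 0 0 v s.
Definition gauss_kernel1 v s := - gauss_mono 1 1 v s.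
Definition gauss_kernel2 v s := gauss_mono 2 2 v s - gauss_mono 0 1 v s.

(** Taylor estimates, uniform for variances between [eps] and [V], of a solution
    [Phi0] of the heat equation [d/dv Phi0 = 1/2 d^2/ds^2 Phi0] with space
    derivatives [Phi1] and [Phi2]. *)
Record heat_flow_bounds (Phi0 Phi1 Phi2 : R -> R -> R) eps V K : Prop := HeatFlowBounds {
  flow_bound : forall v s, eps <= v <= V -> `|Phi0 v s| <= K;
  flow_bound1 : forall v s, eps <= v <= V -> `|Phi1 v s| <= K;
  flow_bound2 : forall v s, eps <= v <= V -> `|Phi2 v s| <= K;
  flow_space0 : forall v s d, eps <= v <= V -> `|Phi0 v (s + d) - Phi0 v s| <= K * `|d|;
  flow_space1 : forall v s d, eps <= v <= V ->
    `|Phi1 v (s + d) - Phi1 v s - d * Phi2 v s| <= K * `|d| ^+ 2;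
  flow_space2 : forall v s d, eps <= v <= V -> `|Phi2 v (s + d) - Phi2 v s| <= K * `|d|;
  flow_taylor : forall v s d, eps <= v <= V ->
    `|Phi0 v (s + d) - Phi0 v s - d * Phi1 v s - 2^-1 * d ^+ 2 * Phi2 v s| <= K * `|d| ^+ 3;
  flow_time0 : forall v s d, eps <= v -> 0 <= d -> v + d <= V ->
    `|Phi0 (v + d) s - Phi0 v s| <= K * d;
  flow_time1 : forall v s d, eps <= v -> 0 <= d -> v + d <= V ->
    `|Phi1 (v + d) s - Phi1 v s| <= K * d;
  flow_time2 : forall v s d, eps <= v -> 0 <= d -> v + d <= V ->
    `|Phi2 (v + d) s - Phi2 v s| <= K * d;
  flow_heat : forall v s d, eps <= v -> 0 <= d -> v + d <= V ->
    `|Phi0 (v + d) s - Phi0 v s - 2^-1 * d * Phi2 v s| <= K * d ^+ 2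
}.

Lemma gauss_kernel_bounds eps V : 0 < eps ->
  exists2 K, 0 <= K & heat_flow_bounds gauss_kernel gauss_kernel1 gauss_kernel2 eps V K.
Proof.
(* [p3] is the third space derivative and [p4 = d/dv gauss_kernel2], half the
   fourth one. *)
move=> e0.
have bd n m : {K | 0 <= K & forall v s, eps <= v <= V -> `|gauss_mono n m v s| <= K}.
  by apply/cid2/gauss_mono_bounded.
pose k n m := s2val (bd n m).
have k0 n m : 0 <= k n m by exact: (s2valP (bd n m)).
have kP n m v s : eps <= v <= V -> `|gauss_mono n m v s| <= k n m.
  exact: (s2valP' (bd n m)).
pose K := k 0 0 + k 1 1 + k 2 2 + k 0 1 + 3 * k 1 2 + k 3 3
          + 3 * k 0 2 + 3 * k 2 3 + k 4 4.
have K0 : 0 <= K by rewrite !addr_ge0 ?mulr_ge0 //.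
have kK : [/\ k 0 0 <= K, k 1 1 <= K, k 2 2 + k 0 1 <= K,
  3 * k 1 2 + k 3 3 <= K & 3 * k 0 2 + 3 * k 2 3 + k 4 4 <= K].
  have := (k0 0 0, k0 1 1, k0 2 2, k0 0 1, k0 1 2, k0 3 3, k0 0 2, k0 2 3, k0 4 4)%N.
  by rewrite /K => -[[[[[[[[]]]]]]]] *; split; lra.
case: kK => K00 K11 K2 K3 K4.
have B0 v s : eps <= v <= V -> `|gauss_kernel v s| <= K.
  by move=> h; apply: le_trans K00; exact: kP.
have B1 v s : eps <= v <= V -> `|gauss_kernel1 v s| <= K.
  by move=> h; rewrite normrN; apply: le_trans K11; exact: kP.
have B2 v s : eps <= v <= V -> `|gauss_kernel2 v s| <= K.
  move=> h; apply: le_trans K2; apply: (le_trans (ler_normB _ _)).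
  by apply: lerD; exact: kP.
pose p3 v s := 3 * gauss_mono 1 2 v s - gauss_mono 3 3 v s.
have B3 v s : eps <= v <= V -> `|p3 v s| <= K.
  move=> h; apply: le_trans K3; apply: (le_trans (ler_normB _ _)).
  by rewrite normrM ger0_norm //; apply: lerD; rewrite ?ler_pM2l //; exact: kP.
pose p4 v s := 3/2 * gauss_mono 0 2 v s - 3 * gauss_mono 2 3 v s + 2^-1 * gauss_mono 4 4 v s.
have B4 v s : eps <= v <= V -> `|p4 v s| <= K.
  move=> h; rewrite /p4.
  have := (kP 0 2 v s h, kP 2 3 v s h, kP 4 4 v s h)%N.
  rewrite !ler_norml => -[[/andP[? ?] /andP[? ?]] /andP[? ?]].
  have := (k0 0 2, k0 2 3, k0 4 4)%N => -[[? ?] ?].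
  by apply/andP; split; lra.
have vne v : eps <= v -> v != 0 by move=> /(lt_le_trans e0) /gt_eqF ->.
have D0 v s t : eps <= v -> is_derive t 1 (fun t => gauss_kernel v (s + t)) (gauss_kernel1 v (s + t)).
  move=> /vne h; apply: (is_derive_eq (is_derive_gauss_mono_space 0 0 s t h)).
  by rewrite mul0r sub0r.
have D1 v s t : eps <= v -> is_derive t 1 (fun t => gauss_kernel1 v (s + t)) (gauss_kernel2 v (s + t)).
  move=> /vne h; apply: (is_derive_eq (is_deriveN (is_derive_gauss_mono_space 1 1 s t h))).
  by rewrite mul1r opprB.
have D2 v s t : eps <= v -> is_derive t 1 (fun t => gauss_kernel2 v (s + t)) (p3 v (s + t)).
  move=> /vne h; apply: (is_derive_eq (is_deriveB (is_derive_gauss_mono_space 2 2 s t h)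
    (is_derive_gauss_mono_space 0 1 s t h))).
  rewrite /p3 /=; ring.
have T0 v s t : 0 < v + t ->
    is_derive t 1 (fun t => gauss_kernel (v + t) s) (2^-1 * gauss_kernel2 (v + t) s).
  move=> h; apply: (is_derive_eq (is_derive_gauss_mono_time 0 0 s h)).
  rewrite /gauss_kernel2; ring.
have T1 v s t : 0 < v + t ->
    is_derive t 1 (fun t => gauss_kernel1 (v + t) s) (2^-1 * p3 (v + t) s).
  move=> h; apply: (is_derive_eq (is_deriveN (is_derive_gauss_mono_time 1 1 s h))).
  by rewrite /p3; lra.
have T2 v s t : 0 < v + t ->
    is_derive t 1 (fun t => gauss_kernel2 (v + t) s) (p4 (v + t) s).
  move=> h; apply: (is_derive_eq (is_deriveB (is_derive_gauss_mono_time 2 2 s h)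
    (is_derive_gauss_mono_time 0 1 s h))).
  by rewrite /p4; lra.
have space0 v s d : eps <= v <= V -> `|gauss_kernel v (s + d) - gauss_kernel v s| <= K * `|d|.
  move=> vV; have /andP[ev _] := vV; rewrite -[X in K * X]expr1.
  apply: (@increment_le (fun t => gauss_kernel v (s + t) - gauss_kernel v s)
    (fun t => gauss_kernel1 v (s + t) - 0)); first by rewrite addr0 subrr.
  move=> t _ _; split; last by rewrite subr0 expr0 mulr1; exact: B1.
  exact: is_derive_sub (D0 _ _ _ ev) (is_derive_cst _ _ _).
have space2 v s d : eps <= v <= V -> `|gauss_kernel2 v (s + d) - gauss_kernel2 v s| <= K * `|d|.
  move=> vV; have /andP[ev _] := vV; rewrite -[X in K * X]expr1.
  apply: (@increment_le (fun t => gauss_kernel2 v (s + t) - gauss_kernel2 v s)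
    (fun t => p3 v (s + t) - 0)); first by rewrite addr0 subrr.
  move=> t _ _; split; last by rewrite subr0 expr0 mulr1; exact: B3.
  exact: is_derive_sub (D2 _ _ _ ev) (is_derive_cst _ _ _).
have space1 v s d : eps <= v <= V ->
    `|gauss_kernel1 v (s + d) - gauss_kernel1 v s - d * gauss_kernel2 v s| <= K * `|d| ^+ 2.
  move=> vV; have /andP[ev _] := vV.
  apply: (@increment_le (fun t => gauss_kernel1 v (s + t) - gauss_kernel1 v s - t * gauss_kernel2 v s)
    (fun t => gauss_kernel2 v (s + t) - 0 - (1 * gauss_kernel2 v s + t * 0))).
    by rewrite addr0 subrr mul0r subrr.
  move=> t _ _; split; last by rewrite subr0 mul1r mulr0 addr0 expr1; exact: space2.
  exact: (is_derive_sub (is_derive_sub (D1 v s t ev) (is_derive_cst _ _ _))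
    (is_derive_mul (is_derive_id _ _) (is_derive_cst _ _ _))).
have taylor v s d : eps <= v <= V ->
    `|gauss_kernel v (s + d) - gauss_kernel v s - d * gauss_kernel1 v s - 2^-1 * d ^+ 2 * gauss_kernel2 v s|
    <= K * `|d| ^+ 3.
  move=> vV; have /andP[ev _] := vV.
  apply: (@increment_le
    (fun t => gauss_kernel v (s + t) - gauss_kernel v s - t * gauss_kernel1 v s - 2^-1 * t ^+ 2 * gauss_kernel2 v s)
    (fun t => gauss_kernel1 v (s + t) - 0 - (1 * gauss_kernel1 v s + t * 0)
      - ((0 * t ^+ 2 + 2^-1 * (2 * t ^+ 1 * 1)) * gauss_kernel2 v s + 2^-1 * t ^+ 2 * 0))).
    by rewrite addr0 expr0n mulr0 !mul0r !subr0 subrr.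
  move=> t _ _; split; last first.
    apply: (le_trans _ (space1 v s t vV)); rewrite le_eqVlt; apply/orP; left; apply/eqP.
    by congr (`|_|); lra.
  have h1 : is_derive t 1 (fun t => 2^-1 * t ^+ 2 * gauss_kernel2 v s)
      ((0 * t ^+ 2 + 2^-1 * (2 * t ^+ 1 * 1)) * gauss_kernel2 v s + 2^-1 * t ^+ 2 * 0).
    have hq := @is_derive_exprn id 2 t 1 (is_derive_id _ _).
    have hc := is_derive_cst (2^-1 : R) t (1 : R).
    exact: (is_derive_mul (is_derive_mul hc hq) (is_derive_cst (gauss_kernel2 v s) _ _)).
  exact: (is_derive_sub (is_derive_sub
      (is_derive_sub (D0 v s t ev) (is_derive_cst _ _ _))
      (is_derive_mul (is_derive_id _ _) (is_derive_cst _ _ _))) h1).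
have seg v d t : eps <= v -> 0 <= d -> v + d <= V -> 0 <= t * d -> `|t| <= `|d| ->
    0 < v + t /\ eps <= v + t <= V.
  move=> ev d0 vdV td0 td; rewrite (ger0_norm d0) in td.
  have t0 : 0 <= t.
    have [d1|d1] := ltP 0 d; first by rewrite -(pmulr_lge0 _ d1).
    by move: td; rewrite (le_anti (_ : d <= 0 <= d)) ?d1 // normr_le0 => /eqP ->.
  by rewrite (ger0_norm t0) in td; split; [|apply/andP; split]; lra.
have time0 v s d : eps <= v -> 0 <= d -> v + d <= V -> `|gauss_kernel (v + d) s - gauss_kernel v s| <= K * d.
  move=> ev d0 vdV; rewrite -{2}(ger0_norm d0) -[`|d|]expr1.
  apply: (@increment_le (fun t => gauss_kernel (v + t) s - gauss_kernel v s)
    (fun t => 2^-1 * gauss_kernel2 (v + t) s - 0)); first by rewrite addr0 subrr.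
  move=> t td0 td; have [vt vtV] := seg _ _ _ ev d0 vdV td0 td.
  split; first exact: is_derive_sub (T0 _ _ _ vt) (is_derive_cst _ _ _).
  by rewrite subr0 expr0 mulr1 normrM ger0_norm //; have := B2 _ s vtV; have := normr_ge0 (gauss_kernel2 (v + t) s); lra.
have time1 v s d : eps <= v -> 0 <= d -> v + d <= V -> `|gauss_kernel1 (v + d) s - gauss_kernel1 v s| <= K * d.
  move=> ev d0 vdV; rewrite -{2}(ger0_norm d0) -[`|d|]expr1.
  apply: (@increment_le (fun t => gauss_kernel1 (v + t) s - gauss_kernel1 v s)
    (fun t => 2^-1 * p3 (v + t) s - 0)); first by rewrite addr0 subrr.
  move=> t td0 td; have [vt vtV] := seg _ _ _ ev d0 vdV td0 td.
  split; first exact: is_derive_sub (T1 _ _ _ vt) (is_derive_cst _ _ _).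
  by rewrite subr0 expr0 mulr1 normrM ger0_norm //; have := B3 _ s vtV; have := normr_ge0 (p3 (v + t) s); lra.
have time2 v s d : eps <= v -> 0 <= d -> v + d <= V -> `|gauss_kernel2 (v + d) s - gauss_kernel2 v s| <= K * d.
  move=> ev d0 vdV; rewrite -{2}(ger0_norm d0) -[`|d|]expr1.
  apply: (@increment_le (fun t => gauss_kernel2 (v + t) s - gauss_kernel2 v s)
    (fun t => p4 (v + t) s - 0)); first by rewrite addr0 subrr.
  move=> t td0 td; have [vt vtV] := seg _ _ _ ev d0 vdV td0 td.
  split; first exact: is_derive_sub (T2 _ _ _ vt) (is_derive_cst _ _ _).
  by rewrite subr0 expr0 mulr1; exact: B4.
have heat v s d : eps <= v -> 0 <= d -> v + d <= V ->
    `|gauss_kernel (v + d) s - gauss_kernel v s - 2^-1 * d * gauss_kernel2 v s| <= K * d ^+ 2.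
  move=> ev d0 vdV; rewrite -[X in K * X ^+ 2](ger0_norm d0).
  apply: (@increment_le (fun t => gauss_kernel (v + t) s - gauss_kernel v s - 2^-1 * t * gauss_kernel2 v s)
    (fun t => 2^-1 * gauss_kernel2 (v + t) s - 0
       - ((0 * t + 2^-1 * 1) * gauss_kernel2 v s + 2^-1 * t * 0))).
    by rewrite addr0 mulr0 mul0r !subr0 subrr.
  move=> t td0 td; have [vt vtV] := seg _ _ _ ev d0 vdV td0 td; split.
    exact: (is_derive_sub (is_derive_sub (T0 v s t vt) (is_derive_cst _ _ _))
      (is_derive_mul (is_derive_mul (is_derive_cst _ _ _) (is_derive_id _ _))
        (is_derive_cst _ _ _))).
  have t0 : 0 <= t.
    have [d1|d1] := ltP 0 d; first by rewrite -(pmulr_lge0 _ d1).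
    by move: td; rewrite (le_anti (_ : d <= 0 <= d)) ?d1 // normr0 normr_le0 => /eqP ->.
  have h : `|gauss_kernel2 (v + t) s - gauss_kernel2 v s| <= K * t.
    apply: time2 => //; rewrite (ger0_norm d0) (ger0_norm t0) in td; lra.
  rewrite mulr0 addr0 subr0 mul0r add0r mulr1 -mulrBr normrM ger0_norm // expr1.
  rewrite (ger0_norm t0); have := normr_ge0 (gauss_kernel2 (v + t) s - gauss_kernel2 v s); lra.
by exists K.
Qed.
End GaussianFlow.

(** * Transfer operators and correctors *)

Section TransferOperator.
Variables (R : realType) (n : nat) (A : 'M[R]_n.+1) (f : 'I_n.+1 -> R).
Hypothesis A0 : forall i j, 0 <= A i j.
Implicit Types (F : R -> 'I_n.+1 -> R) (q s : R) (x : 'cV[R]_n.+1).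

Definition transfer q F : R -> 'I_n.+1 -> R :=
  fun s i => \sum_j A i j * F (s + q * f i) j.

Lemma iter_transferB q k F1 F2 s i :
  iter k (transfer q) (fun s i => F1 s i - F2 s i) s i =
  iter k (transfer q) F1 s i - iter k (transfer q) F2 s i.
Proof.
elim: k s i => [//|k IH] s i /=; rewrite /transfer -sumrB; apply: eq_bigr => j _.
by rewrite -mulrBr -IH.
Qed.

Lemma iter_transfer_le q k F c s i : (forall s j, `|F s j| <= c) ->
  `|iter k (transfer q) F s i| <= c * \sum_j (A ^+ k) i j.
Proof.
move=> Fc; elim: k s i => [|k IH] s i.
  rewrite expr0 /= (bigD1 i) //= mxE eqxx big1 ?addr0 ?mulr1 // => j ji.
  by rewrite mxE eq_sym (negPf ji).
rewrite iterS /transfer; apply: (le_trans (ler_norm_sum _ _ _)).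
have -> : c * \sum_j (A ^+ k.+1) i j = \sum_j A i j * (c * \sum_h (A ^+ k) j h).
  under [RHS]eq_bigr do rewrite mulrCA mulr_sumr.
  rewrite -mulr_sumr exchange_big /=; congr (_ * _); apply: eq_bigr => j _.
  by rewrite exprS -mulmxE mxE.
by apply: ler_sum => j _; rewrite normrM ger0_norm // ler_wpM2l.
Qed.

Variable B : R.
Hypothesis powB : forall k i, \sum_j (A ^+ k) i j <= B.

Lemma iter_transfer_bound q k F c s i : (forall s j, `|F s j| <= c) ->
  `|iter k (transfer q) F s i| <= c * B.
Proof.
move=> Fc; apply: (le_trans (iter_transfer_le _ _ _ _ Fc)); rewrite ler_wpM2l //.
exact: le_trans (normr_ge0 _) (Fc s i).
Qed.

(** One-step errors of size [c] add up: the operator does not expand the sup norm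
    by more than [B] under iteration. *)
Lemma transfer_telescope q k (F : nat -> R -> 'I_n.+1 -> R) c s i : 0 <= c ->
  (forall m, (m < k)%N -> forall s i, `|transfer q (F m) s i - F m.+1 s i| <= c) ->
  `|iter k (transfer q) (F 0%N) s i - F k s i| <= k%:R * (c * B).
Proof.
move=> c0; elim: k F => [|k IH] F Fc; first by rewrite subrr normr0 mul0r.
rewrite iterSr; pose D s i := transfer q (F 0%N) s i - F 1%N s i.
have -> : iter k (transfer q) (transfer q (F 0%N)) s i - F k.+1 s i =
   iter k (transfer q) D s i + (iter k (transfer q) (F 1%N) s i - F k.+1 s i).
  by rewrite iter_transferB addrA subrK.
rewrite -natr1 mulrDl mul1r addrC; apply: (le_trans (ler_normD _ _)); apply: lerD.
  by apply: (IH (fun m => F m.+1)) => m mk; apply: Fc.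
by apply: iter_transfer_bound; apply: Fc.
Qed.

(** For a fixed number of steps and [q] small, the first variable hardly moves,
    so that the operator acts as the matrix alone. *)
Lemma iter_transfer_slowly_varying (Phi : R -> R) K x m :
  0 <= K -> (forall s d, `|Phi (s + d) - Phi s| <= K * `|d|) ->
  exists2 C, 0 <= C & forall q s i, 0 <= q ->
    `|iter m (transfer q) (fun s j => x j 0 * Phi s) s i - (A ^+ m *m x) i 0 * Phi s|
    <= C * q.
Proof.
move=> K0 KP; elim: m => [|m [C C0 IH]].
  by exists 0 => // q s i q0; rewrite expr0 /= mul1mx subrr normr0 mul0r.
pose u := A ^+ m.+1 *m x.
have S0 : 0 <= \sum_i `|u i 0| * (K * `|f i|) by apply: sumr_ge0 => i _; rewrite !mulr_ge0.
have B0 : 0 <= B by apply: le_trans (powB 1 ord0); rewrite expr1; apply: sumr_ge0.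
exists (B * C + \sum_i `|u i 0| * (K * `|f i|)); first by rewrite addr_ge0 ?mulr_ge0.
move=> q s i q0; rewrite iterS /transfer -/u.
have uE : u i 0 = \sum_j A i j * (A ^+ m *m x) j 0.
  by rewrite /u exprS -mulmxE -mulmxA mxE.
rewrite -[X in X - _](subrK (u i 0 * Phi (s + q * f i))) -addrA mulrDl.
apply: (le_trans (ler_normD _ _)); apply: lerD.
  rewrite {1}uE mulr_suml -sumrB; apply: (le_trans (ler_norm_sum _ _ _)).
  apply: (@le_trans _ _ (\sum_j A i j * (C * q))).
    apply: ler_sum => j _; rewrite -mulrA -mulrBr normrM ger0_norm // ler_wpM2l //.
    exact: IH.
  rewrite -mulr_suml -mulrA ler_wpM2r ?mulr_ge0 //.
  by have := powB 1 i; rewrite expr1.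
rewrite -mulrBr normrM mulr_suml (bigD1 i) //=; apply: ler_wpDr.
  by apply: sumr_ge0 => j _; rewrite !mulr_ge0.
rewrite -mulrA ler_wpM2l //; apply: (le_trans (KP _ _)).
by rewrite normrM (ger0_norm q0) -mulrA [q * _]mulrC.
Qed.

End TransferOperator.

(** The two equations on [a] and [b] say that the terms of orders [q] and [q^2]
    cancel in the difference of the corrected flow after one transfer step and
    after the variance has grown by [s2 * q ^+ 2]. Here [rho], [alpha], [beta]
    stand for the [i]th entries of [r], [A a], [A b]. *)
Lemma corrector_step (R : realType) (Phi0 Phi1 Phi2 : R -> R -> R) eps V K
    (rho alpha beta phi a b s2 : R) :
  heat_flow_bounds Phi0 Phi1 Phi2 eps V K -> 0 <= K -> 0 <= s2 ->
  a = phi * rho + alpha ->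
  b = beta + 2^-1 * phi ^+ 2 * rho + phi * alpha - 2^-1 * s2 * rho ->
  exists2 C, 0 <= C & forall q v s, 0 <= q <= 1 -> eps <= v -> v + s2 * q ^+ 2 <= V ->
  `|rho * Phi0 v (s + q * phi) + q * alpha * Phi1 v (s + q * phi)
     + q ^+ 2 * beta * Phi2 v (s + q * phi)
    - (rho * Phi0 (v + s2 * q ^+ 2) s + q * a * Phi1 (v + s2 * q ^+ 2) s
       + q ^+ 2 * b * Phi2 (v + s2 * q ^+ 2) s)| <= C * q ^+ 3.
Proof.
move=> fb K0 s20 aE bE.
exists (K * (`|rho| * `|phi| ^+ 3 + `|alpha| * `|phi| ^+ 2 + `|beta| * `|phi|
   + `|rho| * s2 ^+ 2 + `|a| * s2 + `|b| * s2)).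
  by rewrite mulr_ge0 // !addr_ge0 // !mulr_ge0 // ?exprn_ge0.
move=> q v s /andP[q0 q1] ev vV; set eta := s2 * q ^+ 2.
have eta0 : 0 <= eta by rewrite mulr_ge0 // exprn_ge0.
have evV : eps <= v <= V by rewrite ev (le_trans _ vV) // lerDl.
have R0 := flow_taylor fb s (q * phi) evV.
have R1 := flow_space1 fb s (q * phi) evV.
have R2 := flow_space2 fb s (q * phi) evV.
have S0 := flow_heat fb s ev eta0 vV.
have S1 := flow_time1 fb s ev eta0 vV.
have S2 := flow_time2 fb s ev eta0 vV.
move: R0 R1 R2 S0 S1 S2.
set p0 := Phi0 v s; set p1 := Phi1 v s; set p2 := Phi2 v s.
set r0 := (X in `|X| <= _) => R0.
set r1 := (X in `|X| <= _) => R1.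
set r2 := (X in `|X| <= _) => R2.
set t0 := (X in `|X| <= _) => S0.
set t1 := (X in `|X| <= _) => S1.
set t2 := (X in `|X| <= _) => S2.
have -> : rho * Phi0 v (s + q * phi) + q * alpha * Phi1 v (s + q * phi)
     + q ^+ 2 * beta * Phi2 v (s + q * phi)
    - (rho * Phi0 (v + eta) s + q * a * Phi1 (v + eta) s
       + q ^+ 2 * b * Phi2 (v + eta) s) =
   rho * r0 + q * alpha * r1 + q ^+ 2 * beta * r2
   - rho * t0 - q * a * t1 - q ^+ 2 * b * t2.
  by rewrite /r0 /r1 /r2 /t0 /t1 /t2 /eta aE bE; field.
have q4 : q ^+ 4 <= q ^+ 3 by rewrite exprSr ler_piMr // exprn_ge0.
have e3 : `|q * phi| ^+ 3 = q ^+ 3 * `|phi| ^+ 3 by rewrite normrM exprMn (ger0_norm q0).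
have e2 : `|q * phi| ^+ 2 = q ^+ 2 * `|phi| ^+ 2 by rewrite normrM exprMn (ger0_norm q0).
have e1 : `|q * phi| = q * `|phi| by rewrite normrM (ger0_norm q0).
rewrite e3 in R0; rewrite e2 in R1; rewrite e1 in R2.
have q30 : 0 <= q ^+ 3 by rewrite exprn_ge0.
have q20 : 0 <= q ^+ 2 by rewrite exprn_ge0.
have -> : K * (`|rho| * `|phi| ^+ 3 + `|alpha| * `|phi| ^+ 2 + `|beta| * `|phi|
   + `|rho| * s2 ^+ 2 + `|a| * s2 + `|b| * s2) * q ^+ 3 =
  `|rho| * (K * (q ^+ 3 * `|phi| ^+ 3)) + q * `|alpha| * (K * (q ^+ 2 * `|phi| ^+ 2))
  + q ^+ 2 * `|beta| * (K * (q * `|phi|)) + `|rho| * (K * (s2 ^+ 2 * q ^+ 3))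
  + q * `|a| * (K * eta) + `|b| * (K * s2) * q ^+ 3 by rewrite /eta; ring.
have qq (c : R) : `|q * c| = q * `|c| by rewrite normrM ger0_norm.
have qqq (c : R) : `|q ^+ 2 * c| = q ^+ 2 * `|c| by rewrite normrM ger0_norm.
apply: (le_trans (ler_normB _ _)); apply: lerD; last first.
  rewrite normrM qqq; apply: (le_trans (ler_wpM2l _ S2)); first by rewrite mulr_ge0.
  have -> : q ^+ 2 * `|b| * (K * eta) = `|b| * (K * s2) * q ^+ 4 by rewrite /eta; ring.
  by rewrite ler_wpM2l // !mulr_ge0.
apply: (le_trans (ler_normB _ _)); apply: lerD; last first.
  by rewrite normrM qq ler_wpM2l // mulr_ge0.
apply: (le_trans (ler_normB _ _)); apply: lerD; last first.
  rewrite normrM ler_wpM2l //; apply: (le_trans S0).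
  rewrite /eta exprMn -exprM ler_wpM2l // ler_wpM2l // exprn_ge0 //.
apply: (le_trans (ler_normD _ _)); apply: lerD; last first.
  by rewrite normrM qqq ler_wpM2l // mulr_ge0.
apply: (le_trans (ler_normD _ _)); apply: lerD; last first.
  by rewrite normrM qq ler_wpM2l // mulr_ge0.
by rewrite normrM ler_wpM2l.
Qed.

Lemma inv_sqrt_small (R : realType) (C e : R) : 0 < e ->
  exists k0, forall k, (k0 <= k)%N -> C * (Num.sqrt k.+1%:R)^-1 <= e.
Proof.
move=> e0; exists (Num.truncn ((C / e) ^+ 2)) => k k0.
have q0 : 0 < Num.sqrt k.+1%:R :> R by rewrite sqrtr_gt0.
rewrite ler_pdivrMr // -ler_pdivrMl // mulrC.
apply: (le_trans (ler_norm _)); rewrite -sqrtr_sqr ler_wsqrtr //.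
apply: ltW; apply: lt_le_trans (truncnS_gt _) _.
by rewrite ler_nat.
Qed.

Section TransferLimit.
Variables (R : realType) (n : nat) (A : 'M[R]_n.+1) (f : 'I_n.+1 -> R).
Variables (l : 'rV[R]_n.+1) (r : 'cV[R]_n.+1).
Hypothesis A0 : forall i j, 0 <= A i j.
Hypotheses (Ar : A *m r = r) (lA : l *m A = l) (lr1 : (l *m r) 0 0 = 1).
Hypothesis powA : forall i j, (fun k => (A ^+ k) i j) @ \oo --> (r i 0 * l 0 j).
Variables (a b : 'cV[R]_n.+1) (s2 : R).
Hypothesis s20 : 0 <= s2.
Hypothesis aE : forall i, a i 0 = f i * r i 0 + (A *m a) i 0.
Hypothesis bE : forall i, b i 0 = (A *m b) i 0 + 2^-1 * f i ^+ 2 * r i 0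
  + f i * (A *m a) i 0 - 2^-1 * s2 * r i 0.
Variables (Phi0 Phi1 Phi2 : R -> R -> R) (eps K : R).
Hypotheses (fb : heat_flow_bounds Phi0 Phi1 Phi2 eps (eps + s2) K) (K0 : 0 <= K).

(** Split [w = u + c r] with [c = l w]. The part [c r], once corrected, follows
    the heat flow with an error [O(q^3)] at each of the [k ~ q^-2] steps. For the
    part [u], [m] steps of the operator make [A ^+ m *m u] small before [q] is
    chosen, and the [k - m] other steps cannot enlarge it by more than [B]. *)
Lemma transfer_limit (w : 'cV[R]_n.+1) (eta : R) : 0 < eta ->
  exists k0, forall k, (k0 <= k)%N -> forall s i,
  let q := (Num.sqrt k.+1%:R)^-1 in
  `|iter k (transfer A f q) (fun s j => w j 0 * Phi0 eps (s + q * f j)) s i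
    - r i 0 * (l *m w) 0 0 * Phi0 (eps + s2) s| <= eta.
Proof.
move=> eta0; set c := (l *m w) 0 0.
pose u := w - c *: r; pose rr := c *: r; pose aa := c *: a; pose bb := c *: b.
have lu : (l *m u) 0 0 = 0 by rewrite mulmxBr -scalemxAr mxE [X in _ + X]mxE [X in _ - X]mxE lr1 mulr1 subrr.
have [B powB] := power_bounded powA.
have B0 : 0 <= B.
  apply: le_trans (powB 1%N ord0); rewrite expr1; exact: sumr_ge0.
have aaE i : aa i 0 = f i * rr i 0 + (A *m aa) i 0.
  by rewrite /aa /rr -scalemxAr !mxE aE !mxE; ring.
have bbE i : bb i 0 = (A *m bb) i 0 + 2^-1 * f i ^+ 2 * rr i 0
    + f i * (A *m aa) i 0 - 2^-1 * s2 * rr i 0.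
  by rewrite /bb /aa /rr -!scalemxAr !mxE bE !mxE; ring.
pose C i := s2val (cid2 (corrector_step fb K0 s20 (aaE i) (bbE i))).
have C0 i : 0 <= C i by exact: (s2valP (cid2 (corrector_step fb K0 s20 (aaE i) (bbE i)))).
have CP i := s2valP' (cid2 (corrector_step fb K0 s20 (aaE i) (bbE i))).
pose Ct := \sum_i C i.
have Ct0 : 0 <= Ct by exact: sumr_ge0.
pose C1 := \sum_i (`|w i 0| * (K * `|f i|) + `|aa i 0| * K + `|bb i 0| * K).
have C1i0 i : 0 <= `|w i 0| * (K * `|f i|) + `|aa i 0| * K + `|bb i 0| * K.
  by rewrite !addr_ge0 ?mulr_ge0.
have C1i i : `|w i 0| * (K * `|f i|) + `|aa i 0| * K + `|bb i 0| * K <= C1.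
  by rewrite /C1 (bigD1 i) //= lerDl sumr_ge0.
have C10 : 0 <= C1 by exact: sumr_ge0.
pose C2 := \sum_i `|rr i 0| * (K * s2).
have C2i i : `|rr i 0| * (K * s2) <= C2.
  by rewrite /C2 (bigD1 i) //= lerDl sumr_ge0 // => j _; rewrite !mulr_ge0.
pose e1 := eta / (2 * (B * K + 1)).
have BK1 : 0 < B * K + 1 by rewrite ltr_wpDl // mulr_ge0.
have e10 : 0 < e1 by rewrite divr_gt0 // mulr_gt0.
have [m um] : exists m, forall i, `|(A ^+ m *m u) i 0| <= e1.
  have : \forall m \near \oo, forall i, `|(A ^+ m *m u) i 0| <= e1.
    apply: filter_forall => i.
    have := @power_vec_cvg _ _ _ _ _ powA u i; rewrite lu mulr0 => /cvgrPdist_le /(_ _ e10).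
    by apply: filterS => k; rewrite sub0r normrN.
  by case=> m _ /(_ m (leqnn m)); exists m.
have eV : eps <= eps <= eps + s2 by rewrite lexx lerDl.
have [Cm Cm0 slow] := iter_transfer_slowly_varying f A0 powB u m K0
  (fun s d => flow_space0 fb s d eV).
(* [Q * q] bounds all the errors but the one of size [e1] due to [u]. *)
pose Q := B * C1 + B * Cm + Ct * B + C1 + C2.
have [k1 small] := inv_sqrt_small Q (divr_gt0 eta0 (ltr0n R 2)).
exists (maxn m k1) => k; rewrite geq_max => /andP[mk /small {}small] s i /=.
set q := (Num.sqrt _)^-1 in small *.
have q0 : 0 < q by rewrite invr_gt0 sqrtr_gt0.
have q2 : q ^+ 2 * k.+1%:R = 1 by rewrite exprVn sqr_sqrtr // mulVf.
have q2' : q ^+ 2 * k%:R = 1 - q ^+ 2.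
  by rewrite -[X in X - _]q2 -natr1 mulrDr mulr1 addrK.
have q20 : 0 <= q ^+ 2 by rewrite exprn_ge0 // ltW.
have q1 : q <= 1.
  have k10 : 0 <= k%:R :> R by [].
  have : q ^+ 2 <= 1 by rewrite -subr_ge0 -q2' mulr_ge0.
  by rewrite expr_le1 // ltW.
have qq : q ^+ 2 <= q by rewrite expr2 ler_piMl // ltW.
have nq (x : R) : `|q * x| = q * `|x| by rewrite normrM gtr0_norm.
have nq2 (x : R) : `|q ^+ 2 * x| = q ^+ 2 * `|x| by rewrite normrM (ger0_norm q20).
pose F v (s : R) i := rr i 0 * Phi0 v s + q * aa i 0 * Phi1 v s + q ^+ 2 * bb i 0 * Phi2 v s.
pose v (h : nat) := eps + h%:R * (s2 * q ^+ 2).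
have vV h : (h <= k)%N -> eps <= v h <= eps + s2.
  move=> hk; have x0 : 0 <= h%:R * (s2 * q ^+ 2) by rewrite mulr_ge0 // mulr_ge0.
  rewrite /v lerDl x0 lerD2l mulrCA ler_piMr // mulrC.
  apply: (le_trans (ler_wpM2l q20 (_ : h%:R <= k%:R))); first by rewrite ler_nat.
  by rewrite q2' gerDl oppr_le0.
have FP h s' j : (h <= k)%N ->
    `|F (v h) s' j - rr j 0 * Phi0 (v h) s'| <= q * (`|aa j 0| * K + `|bb j 0| * K).
  move=> /vV hV.
  have -> : F (v h) s' j - rr j 0 * Phi0 (v h) s' =
      q * (aa j 0 * Phi1 (v h) s') + q ^+ 2 * (bb j 0 * Phi2 (v h) s') by rewrite /F; ring.
  rewrite mulrDr; apply: (le_trans (ler_normD _ _)).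
  rewrite nq2 nq [`|aa j 0 * _|]normrM [`|bb j 0 * _|]normrM; apply: lerD.
    apply: ler_wpM2l; first exact: ltW.
    by apply: ler_wpM2l => //; apply: (flow_bound1 fb).
  apply: (ler_pM q20 _ qq); first by apply: mulr_ge0.
  by apply: ler_wpM2l => //; apply: (flow_bound2 fb).
have uE j : u j 0 = w j 0 - rr j 0 by rewrite /u /rr !mxE.
pose H s' j := w j 0 * Phi0 eps (s' + q * f j).
pose G s' j := u j 0 * Phi0 eps s' + F eps s' j.
have dHG s' j : `|H s' j - G s' j| <= q * C1.
  have -> : H s' j - G s' j = w j 0 * (Phi0 eps (s' + q * f j) - Phi0 eps s')
      - (F (v 0%N) s' j - rr j 0 * Phi0 (v 0%N) s').
    by rewrite /H /G /v mul0r addr0 uE; ring.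
  apply: (le_trans (ler_normB _ _)).
  apply: (@le_trans _ _ (q * (`|w j 0| * (K * `|f j|)) +
      q * (`|aa j 0| * K + `|bb j 0| * K))).
    apply: lerD; last exact: FP.
    rewrite normrM mulrCA ler_wpM2l //; apply: (le_trans (flow_space0 fb _ _ eV)).
    by rewrite nq mulrCA.
  by rewrite -mulrDr addrA; apply: ler_wpM2l (C1i j); exact: ltW.
pose T := transfer A f q.
have E1 : `|iter k T H s i - iter k T G s i| <= q * C1 * B.
  by rewrite -iter_transferB; exact: iter_transfer_bound.
have E2 : `|iter k T G s i - iter k T (F eps) s i| <= (e1 * K + Cm * q) * B.
  rewrite -iter_transferB -(subnK mk) iterD; apply: iter_transfer_bound => // s' j.
  have -> : (fun s i => G s i - F eps s i) = (fun s i => u i 0 * Phi0 eps s).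
    by apply/funext => x; apply/funext => y; rewrite /G addrK.
  rewrite -[X in `|X|](subrK ((A ^+ m *m u) j 0 * Phi0 eps s')) addrC.
  apply: (le_trans (ler_normD _ _)); apply: lerD.
    rewrite normrM; apply: ler_pM => //; exact: flow_bound fb _ _ _.
  by apply: slow; rewrite ltW.
have E3 : `|iter k T (F eps) s i - F (v k) s i| <= k%:R * (Ct * q ^+ 3 * B).
  have -> : F eps = F (v 0%N) by rewrite /v mul0r addr0.
  apply: (transfer_telescope A0 powB (F := fun h => F (v h))).
    by rewrite mulr_ge0 // exprn_ge0 // ltW.
  move=> h hk s' j.
  have -> : v h.+1 = v h + s2 * q ^+ 2 by rewrite /v -natr1 mulrDl mul1r addrA.
  have /andP[ev _] := vV h (ltnW hk).
  have : v h + s2 * q ^+ 2 <= eps + s2.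
    have /andP[_] := vV h.+1 hk.
    by rewrite /v -natr1 mulrDl mul1r addrA.
  have q01 : 0 <= q <= 1 by rewrite ltW.
  move=> /(CP j q (v h) s' q01 ev).
  have -> : transfer A f q (F (v h)) s' j = rr j 0 * Phi0 (v h) (s' + q * f j) +
     q * (A *m aa) j 0 * Phi1 (v h) (s' + q * f j) +
     q ^+ 2 * (A *m bb) j 0 * Phi2 (v h) (s' + q * f j).
    have {1}-> : rr = A *m rr by rewrite /rr -scalemxAr Ar.
    rewrite /transfer !mxE !(mulr_sumr, mulr_suml) -!big_split /=.
    by apply: eq_bigr => h' _; rewrite /F; ring.
  move=> /le_trans; apply; rewrite ler_wpM2r ?exprn_ge0 ?(ltW q0) //.
  by rewrite /Ct (bigD1 j) //= lerDl sumr_ge0.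
have E4 : `|F (v k) s i - rr i 0 * Phi0 (v k) s| <= q * C1.
  apply: (le_trans (FP _ _ _ (leqnn k))); rewrite ler_wpM2l ?(ltW q0) //.
  by apply: le_trans (C1i i); rewrite -addrA lerDr !mulr_ge0.
have E5 : `|rr i 0 * Phi0 (v k) s - rr i 0 * Phi0 (eps + s2) s| <= q * C2.
  have -> : eps + s2 = v k + s2 * q ^+ 2.
    by rewrite /v mulrCA [k%:R * _]mulrC q2'; ring.
  rewrite -mulrBr normrM distrC.
  apply: (@le_trans _ _ (`|rr i 0| * (K * (s2 * q ^+ 2)))).
    rewrite ler_wpM2l //; apply: (flow_time0 fb).
    - by have /andP[] := vV k (leqnn k).
    - by rewrite mulr_ge0.
    - by rewrite /v mulrCA [k%:R * _]mulrC q2'; lra.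
  have -> : `|rr i 0| * (K * (s2 * q ^+ 2)) = q ^+ 2 * (`|rr i 0| * (K * s2)) by ring.
  by apply: ler_pM => //; rewrite !mulr_ge0.
have E3' : k%:R * (Ct * q ^+ 3 * B) <= q * (Ct * B).
  have -> : k%:R * (Ct * q ^+ 3 * B) = (q ^+ 2 * k%:R) * (q * (Ct * B)) by ring.
  by rewrite q2' ler_piMl ?mulr_ge0 ?(ltW q0) // gerDl oppr_le0.
have e1B : e1 * K * B <= eta / 2.
  have -> : e1 * K * B = eta / 2 * ((B * K) / (B * K + 1)) by rewrite /e1; field; rewrite gt_eqF.
  rewrite ler_piMr ?divr_ge0 ?(ltW eta0) // ler_pdivrMr // mul1r lerDl //.
suff : `|iter k T H s i - rr i 0 * Phi0 (eps + s2) s| <= eta.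
  by rewrite [rr i 0]mxE [c * _]mulrC.
have -> : iter k T H s i - rr i 0 * Phi0 (eps + s2) s =
  (iter k T H s i - iter k T G s i) + (iter k T G s i - iter k T (F eps) s i)
  + (iter k T (F eps) s i - F (v k) s i) + (F (v k) s i - rr i 0 * Phi0 (v k) s)
  + (rr i 0 * Phi0 (v k) s - rr i 0 * Phi0 (eps + s2) s) by ring.
have tot : q * C1 * B + (e1 * K + Cm * q) * B + q * (Ct * B) + q * C1 + q * C2 =
  e1 * K * B + Q * q by rewrite /Q; ring.
have -> : eta = eta / 2 + eta / 2 by field.
apply: (@le_trans _ _ (e1 * K * B + Q * q)); last exact: lerD.
have E3'' := le_trans E3 E3'.
rewrite -tot; do 4 (apply: (le_trans (ler_normD _ _)); apply: lerD => //).
Qed.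
End TransferLimit.

(** * Convergence in law from Gaussian test functions *)

Section GaussianSmoothing.
Variable R : realType.
Notation mu := (@lebesgue_measure R).
Notation N v m := (normal_pdf m (Num.sqrt v)).
Implicit Types (v m x b M e d : R) (H : R -> R).

Lemma normal_pdf_gauss_kernel v m x : 0 < v ->
  N v m x = (Num.sqrt (pi *+ 2))^-1 * gauss_kernel v (x - m).
Proof.
move=> v0; have s0 : Num.sqrt v != 0 by rewrite gt_eqF // sqrtr_gt0.
rewrite normal_pdfE //= /normal_peak /normal_fun /gauss_kernel /gauss_mono !expr0 !mul1r.
rewrite sqr_sqrtr ?(ltW v0) // mulrA; congr (_ * expR _).
  by rewrite -mulrnAr sqrtrM ?(ltW v0) // invfM mulrC.
by rewrite -mulr_natl invfM mulNr mulNr mulrN.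
Qed.

(** Half of the exponent gives a small factor, by [exp (- t) <= t^-1], and the
    other half is the density of twice the variance; tails are thus controlled
    without computing moments. *)
Lemma normal_pdf_tail v m x d : 0 < v -> 0 < d -> d <= `|x - m| ->
  N v m x <= Num.sqrt 2 * (4 * v / d ^+ 2) * N (2 * v) m x.
Proof.
move=> v0 d0 dx; have v20 : 0 < 2 * v by rewrite mulr_gt0.
rewrite !normal_pdf_gauss_kernel // [X in _ <= X]mulrCA ler_wpM2l ?invr_ge0 ?sqrtr_ge0 //.
rewrite /gauss_kernel /gauss_mono !expr0 !mul1r sqrtrM // [(Num.sqrt 2 * _)^-1]invfM.
set y := (x - m) ^+ 2; set t := y / (4 * v).
have s2 : Num.sqrt 2 != 0 :> R by rewrite gt_eqF // sqrtr_gt0.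
have vne : v != 0 by rewrite gt_eqF.
have -> : y * (- 2^-1 * v^-1) = - t + - t by rewrite /t; field.
have -> : y * (- 2^-1 * (2 * v)^-1) = - t by rewrite /t; field.
have -> : Num.sqrt 2 * (4 * v / d ^+ 2) * ((Num.sqrt 2)^-1 / Num.sqrt v * expR (- t)) =
  (Num.sqrt v)^-1 * ((4 * v / d ^+ 2) * expR (- t)).
  by field; rewrite s2 !gt_eqF // sqrtr_gt0.
rewrite expRD ler_wpM2l ?invr_ge0 ?sqrtr_ge0 // ler_wpM2r ?expR_ge0 //.
have d2y : d ^+ 2 <= y.
  by rewrite /y -[(x - m) ^+ 2]real_normK ?num_real // lerXn2r ?nnegrE ?(ltW d0).
have dd : 0 < d ^+ 2 by rewrite exprn_gt0.
have y0 : 0 < y by exact: lt_le_trans d2y.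
have t0 : 0 < t by rewrite divr_gt0 // mulr_gt0.
apply: (@le_trans _ _ t^-1).
  rewrite expRN lef_pV2 ?posrE ?expR_gt0 //.
  by apply: le_trans (expR_ge1Dx t); rewrite lerDr.
by rewrite /t invf_div ler_pM2l ?mulr_gt0 // lef_pV2 ?posrE.
Qed.

Lemma integrable_bounded_normal H M v m : measurable_fun setT H ->
  (forall x, `|H x| <= M) ->
  mu.-integrable setT (EFin \o (fun b => H b * N v m b)).
Proof.
move=> mH HM.
apply: (@integrableMr _ _ _ mu setT measurableT H (EFin \o N v m)) => //.
  exists M; split; first by rewrite num_real.
  by move=> y My x _ /=; exact: le_trans (HM x) (ltW My).
exact: integrable_normal_pdf.
Qed.

Lemma Rintegral_normal_pdf v m : \int[mu]_b N v m b = 1.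
Proof. by rewrite /Rintegral integral_normal_pdf. Qed.

(** Both densities of the normal law, the given one and the Radon-Nikodym
    derivative, have the same integrals over measurable sets. *)
Lemma integral_normal_prob H M v m : measurable_fun setT H -> (forall x, `|H x| <= M) ->
  (\int[normal_prob m (Num.sqrt v)]_x (H x)%:E = (\int[mu]_b (H b * N v m b))%:E)%E.
Proof.
move=> mH HM.
have iH : mu.-integrable setT (EFin \o (fun b => H b * N v m b)).
  exact: integrable_bounded_normal HM.
rewrite /Rintegral fineK; last exact: integrable_fin_num.
have dom := @normal_prob_dominates R m (Num.sqrt v).
have inu : (normal_prob m (Num.sqrt v)).-integrable setT (EFin \o H).
  apply: measurable_bounded_integrable => //.
    rewrite [X in (X < _)%E](_ : _ = 1%E) ?ltry //.
    exact: (@probability_setT _ _ _ (normal_prob m (Num.sqrt v) : probability _ R)).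
  exists M; split; first by rewrite num_real.
  by move=> y My x _ /=; exact: le_trans (HM x) (ltW My).
rewrite -[LHS](Radon_Nikodym_change_of_variables dom) //=.
apply: ae_eq_integral => //.
- apply: emeasurable_funM; first exact/measurable_EFinP.
  by apply: (measurable_int mu); apply: Radon_Nikodym_integrable.
- exact: measurable_int iH.
under [X in ae_eq _ _ _ X]eq_fun do rewrite EFinM.
apply: ae_eqe_mul2l => /=.
rewrite Radon_NikodymE //=.
case: cid => /= h [h1 h2 h3].
apply: integral_ae_eq => //=.
  by apply/measurableT_comp => //; exact: measurable_normal_pdf.
by move=> E E01 mE; rewrite -h3.
Qed.
End GaussianSmoothing.

Section SmoothingEstimates.
Variable R : realType.
Notation mu := (@lebesgue_measure R).
Notation N v m := (normal_pdf m (Num.sqrt v)).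
Implicit Types (v m x b M e d eta : R) (H f g : R -> R).
Notation integ f := (mu.-integrable setT (EFin \o f)).

Lemma integ_add f g : integ f -> integ g -> integ (fun x => f x + g x).
Proof. by move=> fi gi; have := integrableD measurableT fi gi. Qed.

Lemma integ_sub f g : integ f -> integ g -> integ (fun x => f x - g x).
Proof. by move=> fi gi; have := integrableB measurableT fi gi. Qed.

Lemma integ_scale c f : integ f -> integ (fun x => c * f x).
Proof. by move=> fi; have := integrableZl measurableT c fi. Qed.

Lemma Rintegral_dist_le f g G : integ f -> integ g -> integ G ->
  (forall x, `|f x - g x| <= G x) ->
  `|\int[mu]_x f x - \int[mu]_x g x| <= \int[mu]_x G x.
Proof.
move=> fi gi Gi fg; rewrite -RintegralB //.
apply: (le_trans (le_normr_Rintegral measurableT (integ_sub fi gi))).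
by apply: le_Rintegral => //; exact: (integrable_norm (integ_sub fi gi)).
Qed.

Lemma integ_wsum (I : Type) (s : seq I) (p : I -> R) (g : I -> R -> R) :
  (forall i, integ (g i)) -> integ (fun b => \sum_(i <- s) p i * g i b).
Proof.
move=> gi; elim: s => [|i s IH].
  have -> : (fun b => \sum_(i <- [::]) p i * g i b) = cst 0.
    by apply/funext => b; rewrite big_nil.
  exact: integrable0.
have -> : (fun b => \sum_(j <- i :: s) p j * g j b) =
    (fun b => p i * g i b + \sum_(j <- s) p j * g j b).
  by apply/funext => b; rewrite big_cons.
exact: integ_add (integ_scale _ (gi i)) IH.
Qed.

Lemma Rintegral_wsum (I : Type) (s : seq I) (p : I -> R) (g : I -> R -> R) :
  (forall i, integ (g i)) ->
  \int[mu]_b (\sum_(i <- s) p i * g i b) = \sum_(i <- s) p i * \int[mu]_b g i b.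
Proof.
move=> gi; elim: s => [|i s IH].
  rewrite big_nil; under eq_Rintegral do rewrite big_nil.
  by rewrite Rintegral_cst // mul0r.
rewrite big_cons -IH; under eq_Rintegral do rewrite big_cons.
rewrite RintegralD //; last exact: integ_wsum.
  by rewrite RintegralZl.
exact: integ_scale.
Qed.

Variables (H : R -> R) (M : R).
Hypotheses (mH : measurable_fun setT H) (HM : forall x, `|H x| <= M).

Let M0 : 0 <= M. Proof. exact: le_trans (normr_ge0 _) (HM 0). Qed.

(** The convolution of [H] with the centred Gaussian of variance [v]. At [0] it
    is also the expectation of [H] under that Gaussian. *)
Definition smooth v x := \int[mu]_b (H b * N v x b).

(** Write [H x] as an integral against the density centred at [x], and separate
    the points within [d] of [x] from the tail. *)
Lemma smooth_close e d v x : 0 < d -> (forall x y, `|x - y| < d -> `|H x - H y| <= e) ->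
  0 < v -> `|H x - smooth v x| <= e + 2 * M * (Num.sqrt 2 * (4 * v / d ^+ 2)).
Proof.
move=> d0 He v0; set c := Num.sqrt 2 * _.
have e0 : 0 <= e by have := He 0 0; rewrite subrr normr0 => /(_ d0); rewrite subrr normr0.
have c0 : 0 <= c by rewrite mulr_ge0 ?sqrtr_ge0 // divr_ge0 ?mulr_ge0 ?exprn_ge0 ?ltW.
have Mc0 : 0 <= 2 * M * c by apply: mulr_ge0 c0; rewrite mulr_ge0.
have iN w : integ (N w x) by exact: integrable_normal_pdf.
have -> : H x = \int[mu]_b (H x * N v x b).
  by rewrite RintegralZl // Rintegral_normal_pdf mulr1.
have -> : e + 2 * M * c = \int[mu]_b (e * N v x b + 2 * M * c * N (2 * v) x b).
  by rewrite RintegralD ?RintegralZl ?Rintegral_normal_pdf ?mulr1 //; exact: integ_scale.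
apply: Rintegral_dist_le.
- exact: integ_scale.
- exact: integrable_bounded_normal HM.
- by apply: integ_add; exact: integ_scale.
move=> b; rewrite -mulrBl normrM (ger0_norm (normal_pdf_ge0 _ _ _)).
have [bx|bx] := ltP `|b - x| d.
  rewrite -[X in X <= _]addr0; apply: lerD; last first.
    by apply: mulr_ge0; [exact: Mc0|exact: normal_pdf_ge0].
  by rewrite ler_wpM2r ?normal_pdf_ge0 // He // distrC.
rewrite -[X in X <= _]add0r; apply: lerD; first by rewrite mulr_ge0 ?normal_pdf_ge0.
rewrite -mulrA; apply: ler_pM; rewrite ?normal_pdf_ge0 //; last exact: normal_pdf_tail.
apply: (le_trans (ler_normB _ _)); have := HM x; have := HM b; lra.
Qed.

(** An expectation of a convolution is an integral of expectations of Gaussian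
    densities. *)
Lemma smooth_expectation (T : finType) (p X : T -> R) v w eta : 0 < v -> 0 <= eta ->
  integ H ->
  (forall b, `|\sum_z p z * N v (X z) b - N w 0 b| <= eta) ->
  `|\sum_z p z * smooth v (X z) - smooth w 0| <= eta * \int[mu]_b `|H b|.
Proof.
move=> v0 eta0 iH hp.
have iHN v' m : integ (fun b => H b * N v' m b) by exact: integrable_bounded_normal HM.
have -> : \sum_z p z * smooth v (X z) = \int[mu]_b (\sum_z p z * (H b * N v (X z) b)).
  by rewrite Rintegral_wsum.
have iaH : integ (fun b => `|H b|) by exact: (integrable_norm iH).
rewrite -RintegralZl //; apply: Rintegral_dist_le => //.
- exact: integ_wsum.
- exact: integ_scale.
move=> b; have -> : \sum_z p z * (H b * N v (X z) b) - H b * N w 0 b =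
    H b * (\sum_z p z * N v (X z) b - N w 0 b).
  by rewrite mulrBr mulr_sumr; congr (_ - _); apply: eq_bigr => z _; rewrite mulrCA.
by rewrite normrM mulrC ler_wpM2r.
Qed.

Lemma smooth_time s2 e : 0 < s2 -> 0 < e -> integ H ->
  exists2 v0, 0 < v0 & forall v, 0 < v <= v0 -> `|smooth (v + s2) 0 - smooth s2 0| <= e.
Proof.
move=> s20 e0 iH; have [K K0 fb] := gauss_kernel_bounds (s2 + 1) s20.
pose L := K * \int[mu]_b `|H b| / Num.sqrt (pi *+ 2).
have iaH : integ (fun b => `|H b|) by exact: (integrable_norm iH).
have p0 : 0 < Num.sqrt (pi *+ 2) :> R by rewrite sqrtr_gt0 mulrn_wgt0 // pi_gt0.
have L0 : 0 <= L.
  by rewrite !mulr_ge0 ?invr_ge0 ?sqrtr_ge0 // Rintegral_ge0.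
have L1 : 0 < L + 1 by rewrite ltr_wpDl.
exists (Num.min 1 (e / (L + 1))); first by rewrite lt_min ltr01 divr_gt0.
move=> v /andP[v0]; rewrite le_min => /andP[v1 ve].
have vs : 0 < v + s2 by rewrite addr_gt0.
apply: (@le_trans _ _ (v * L)); last first.
  move: ve; rewrite ler_pdivlMr // => /(le_trans _); apply.
  by rewrite ler_wpM2l ?(ltW v0) // lerDl.
have -> : v * L = \int[mu]_b (K * v / Num.sqrt (pi *+ 2) * `|H b|).
  by rewrite RintegralZl // /L; ring.
apply: Rintegral_dist_le.
- exact: integrable_bounded_normal HM.
- exact: integrable_bounded_normal HM.
- exact: integ_scale.
move=> b; rewrite -mulrBr normrM mulrC ler_wpM2r // !normal_pdf_gauss_kernel //.
rewrite -mulrBr normrM ger0_norm ?invr_ge0 ?sqrtr_ge0 // mulrC ler_wpM2r ?invr_ge0 ?sqrtr_ge0 //.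
by rewrite [v + s2]addrC; apply: (flow_time0 fb); rewrite ?(ltW v0) // lerD2l.
Qed.
End SmoothingEstimates.

Section WeakConvergence.
Variable R : realType.
Notation mu := (@lebesgue_measure R).
Notation N v m := (normal_pdf m (Num.sqrt v)).
Implicit Types (v m x y b M e d A : R) (H h : R -> R).

Lemma compact_support_unif_continuous H A : continuous H ->
  (forall x, A < `|x| -> H x = 0) ->
  forall e, 0 < e -> exists2 d, 0 < d & forall x y, `|x - y| < d -> `|H x - H y| <= e.
Proof.
move=> cH H0 e e0.
have := @segment_compact R (- A) A => /compact_near_coveringP.
move=> /(_ R (0 : R)^'+ (fun d x => forall y, `|x - y| < d -> `|H x - H y| <= e)).
have e20 : 0 < e / 2 by rewrite divr_gt0.
case=> [x _|d /= d0 hd].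
- have /cvgrPdist_lt /(_ _ e20) [d /= d0 hd] := cH x.
  have d20 : 0 < d / 2 by rewrite divr_gt0.
  exists (ball x (d / 2), [set t | t < d / 2]) => /=.
    by split; [exact: nbhsx_ballx | exact: nbhs_right_lt].
  move=> [x' t] /= [xx' td] y x'y.
  rewrite /ball /= in xx' hd.
  have h1 := hd x'; have h2 := hd y.
  have := h1 (lt_trans xx' _); rewrite ltr_pdivrMr // ltr_pMr // ltr1n => /(_ isT) h3.
  have h4 : `|H x - H y| < e / 2.
    apply: h2; apply: (le_lt_trans (ler_distD x' _ _)).
    rewrite [d]splitr; apply: ltrD xx' _; exact: lt_trans x'y td.
  have -> : H x' - H y = (H x - H y) - (H x - H x') by ring.
  by apply: (le_trans (ler_normB _ _)); rewrite [e]splitr lerD // ltW.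
have d20 : 0 < d / 2 by rewrite divr_gt0.
have {}hd : forall x, x \in `[- A, A] -> forall y, `|x - y| < d / 2 -> `|H x - H y| <= e.
  move=> x xA; apply: (hd (d / 2)) => //; rewrite /ball /= sub0r normrN gtr0_norm //.
  by rewrite ltr_pdivrMr // ltr_pMr // ltr1n.
exists (d / 2); first by rewrite divr_gt0.
move=> x y xy.
have inA z : ~~ (A < `|z|) -> z \in `[- A, A] by rewrite -leNgt in_itv /= ler_norml.
have [xA|/inA xA] := boolP (A < `|x|); last exact: hd.
have [yA|/inA yA] := boolP (A < `|y|); last by rewrite distrC; apply: hd; rewrite // distrC.
by rewrite !H0 // subrr normr0 ltW.
Qed.

Lemma compact_support_bounded H A : continuous H -> (forall x, A < `|x| -> H x = 0) ->
  exists M, forall x, `|H x| <= M.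
Proof.
move=> cH H0.
have : compact (H @` `[- A, A]).
  by apply: continuous_compact; [exact: continuous_subspaceT | exact: segment_compact].
move=> /compact_bounded [M [Mr hM]]; exists (`|M| + 1) => x.
have M1 : M < `|M| + 1 by rewrite (le_lt_trans (ler_norm _)) // ltrDl.
have [xA|xA] := ltP A `|x|; first by rewrite H0 // normr0 addr_ge0.
by apply: (hM _ M1); exists x => //=; rewrite in_itv /= -ler_norml.
Qed.

Lemma compact_support_integrable H A : continuous H -> (forall x, A < `|x| -> H x = 0) ->
  mu.-integrable setT (EFin \o H).
Proof.
move=> cH H0.
have -> : EFin \o H = (EFin \o H) \_ `[- A, A].
  apply/funext => x; rewrite patchE; case: ifPn => // /negP xA.
  rewrite /= H0 // ltNge; apply/negP => xA'; apply: xA.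
  by rewrite inE /= in_itv /= -ler_norml.
apply/integrable_restrict => //; rewrite setTI.
apply: continuous_compact_integrable; first exact: segment_compact.
exact: continuous_subspaceT.
Qed.

Definition tent A x : R := Num.max 0 (Num.min 1 (A + 1 - `|x|)).

Lemma continuous_tent A : continuous (tent A).
Proof.
have c1 : continuous (fun x : R => A + 1 - `|x|).
  by move=> x; apply: (@cvgB _ R^o); [exact: cvg_cst|exact: norm_continuous].
have c2 : continuous (fun x : R => Num.min 1 (A + 1 - `|x|)).
  by move=> x; apply: (@continuous_min R R (cst 1) _ x); [exact: cvg_cst|exact: c1].
by move=> x; apply: (@continuous_max R R (cst 0) _ x); [exact: cvg_cst|exact: c2].
Qed.

Lemma tent_ge0 A x : 0 <= tent A x. Proof. by rewrite /tent le_max lexx. Qed.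

Lemma tent_le1 A x : tent A x <= 1.
Proof. by rewrite /tent ge_max ler01 ge_min lexx. Qed.

Lemma tent1 A x : `|x| <= A -> tent A x = 1.
Proof.
move=> xA; rewrite /tent; have -> : Num.min 1 (A + 1 - `|x|) = 1.
  by apply/min_idPl; rewrite lerBrDr addrC lerD2r.
by apply/max_idPr.
Qed.

Lemma tent0 A x : A + 1 < `|x| -> tent A x = 0.
Proof.
move=> xA; rewrite /tent; apply/max_idPl; rewrite ge_min; apply/orP; right.
by rewrite subr_le0 ltW.
Qed.

End WeakConvergence.

Section Portmanteau.
Variables (R : realType) (T : nat -> finType) (p X : forall k, T k -> R).
Hypothesis p_ge0 : forall k (z : T k), 0 <= p z.
Hypothesis p_sum1 : \forall k \near \oo, \sum_(z : T k) p z = 1.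
Notation mu := (@lebesgue_measure R).
Implicit Types (h H : R -> R) (nu : probability (measurableTypeR R) R) (e A M : R).

Lemma bounded_integrable nu h M : measurable_fun setT h -> (forall x, `|h x| <= M) ->
  nu.-integrable setT (EFin \o h).
Proof.
move=> mh hM; apply: measurable_bounded_integrable => //.
  by apply: (le_lt_trans (probability_le1 nu measurableT)); exact: ltry.
exists M; split; first by rewrite num_real.
by move=> y My x _ /=; exact: le_trans (hM x) (ltW My).
Qed.

Lemma probability_segment nu e : 0 < e ->
  exists n : nat, 1 - e <= fine (nu (`[- n%:R, n%:R]%classic : set R)).
Proof.
move=> e0; pose F (n : nat) := `[- n%:R, n%:R]%classic : set R.
have mF n : measurable (F n) by exact: measurable_itv.
have ndF : nondecreasing_seq F.
  move=> n m nm; apply/subsetPset => x; rewrite /F /= !in_itv /= => /andP[x1 x2].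
  have nm' : n%:R <= m%:R :> R by rewrite ler_nat.
  by rewrite (le_trans _ x1) ?lerN2 // (le_trans x2).
have UF : \bigcup_n F n = setT.
  apply/seteqP; split => // x _; exists (Num.truncn `|x|).+1 => //.
  by rewrite /F /= in_itv /= -ler_norml ltW // truncnS_gt.
have := @nondecreasing_cvg_mu _ (measurableTypeR R) R nu F mF (bigcupT_measurable _ mF) ndF.
rewrite UF [X in _ --> X](_ : _ = 1%E); last exact: (probability_setT nu).
move=> /fine_cvgP[_] /cvgrPdist_le /(_ _ e0) [n _ /(_ n (leqnn n))] /=.
by rewrite /= ler_distlC => /andP[h _]; exists n.
Qed.

(** A probability measure on the line is tight. *)
Lemma tent_mass nu e : 0 < e -> exists A, 1 - e <= \int[nu]_x tent A x.
Proof.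
move=> e0; have [n hn] := probability_segment nu e0.
exists n%:R; apply: (le_trans hn).
have mI : measurable (`[- n%:R, n%:R]%classic : set (measurableTypeR R)) by exact: measurable_itv.
have <- : \int[nu]_x \1_(`[- n%:R, n%:R]%classic) x = fine (nu (`[- n%:R, n%:R]%classic : set R)).
  by rewrite /Rintegral integral_indic // setIT.
apply: le_Rintegral => //.
- apply: (@bounded_integrable _ _ 1) => [|x]; first exact: measurable_indic.
  by rewrite indicE; case: (_ \in _); rewrite ?normr1 ?normr0.
- apply: (@bounded_integrable _ _ 1) => [|x].
    by apply: continuous_measurable_fun; exact: continuous_tent.
  by rewrite ger0_norm ?tent_ge0 ?tent_le1.
move=> x _; rewrite indicE; case: (boolP (_ \in _)) => [|_]; last exact: tent_ge0.
by rewrite inE /= in_itv /= -ler_norml => /tent1 ->.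
Qed.

(** The mass that the laws put outside the support of a tent function is at most
    1 minus the integral of the tent, which is itself a test function with
    compact support: no mass escapes to infinity. *)
Lemma cvg_in_law_compact_support nu :
  (forall H A, continuous H -> (forall x, A < `|x| -> H x = 0) -> forall e, 0 < e ->
     \forall k \near \oo, `|\sum_(z : T k) p z * H (X z) - \int[nu]_x H x| <= e) ->
  cvg_in_law p X nu.
Proof.
move=> hyp h ch [M0 [_ hM0]].
have [M MM] : exists M, forall x, `|h x| <= M.
  by exists (M0 + 1) => x; apply: hM0 => //; rewrite ltrDl.
have M_ge0 : 0 <= M by exact: le_trans (normr_ge0 _) (MM 0).
have mh : measurable_fun setT h by exact: continuous_measurable_fun.
have ih : nu.-integrable setT (EFin \o h) by exact: bounded_integrable MM.
rewrite -[X in _ --> X]fineK; last exact: integrable_fin_num.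
apply: cvg_EFin; first by near=> k.
apply/cvgrPdist_le => e e0.
pose e' := e / (3 * M + 1).
have M1 : 0 < 3 * M + 1 by rewrite ltr_wpDl // mulr_ge0.
have e'0 : 0 < e' by rewrite divr_gt0.
have [A tA] := tent_mass nu e'0.
have ct : continuous (tent A) by exact: continuous_tent.
have t0 x : A + 1 < `|x| -> tent A x = 0 by exact: tent0.
pose g x := h x * tent A x.
have cg : continuous g by move=> x; apply: continuousM; [exact: ch|exact: ct].
have g0 x : A + 1 < `|x| -> g x = 0 by move=> /t0 xA; rewrite /g xA mulr0.
have gM x : `|g x| <= M.
  rewrite /g normrM -[M]mulr1; apply: ler_pM => //.
  by rewrite ger0_norm ?tent_ge0 ?tent_le1.
have it : nu.-integrable setT (EFin \o tent A).
  apply: (@bounded_integrable _ _ 1); first exact: continuous_measurable_fun.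
  by move=> x; rewrite ger0_norm ?tent_ge0 ?tent_le1.
have ig : nu.-integrable setT (EFin \o g).
  by apply: bounded_integrable gM; exact: continuous_measurable_fun.
have hg x : `|h x - g x| <= M * (1 - tent A x).
  rewrite /g -{1}[h x]mulr1 -mulrBr normrM; apply: ler_pM => //.
  by rewrite ger0_norm // subr_ge0 tent_le1.
have i1 : nu.-integrable setT (EFin \o cst (1 : R)).
  by apply: (@bounded_integrable _ _ 1) => // x; rewrite normr1.
have i1t : nu.-integrable setT (EFin \o (fun x => M * (1 - tent A x))).
  have := integrableZl measurableT M (integrableB measurableT i1 it); exact.
have third : `|\int[nu]_x g x - \int[nu]_x h x| <= M * e'.
  rewrite -RintegralB //; apply: (le_trans (le_normr_Rintegral _ _)) => //.
    by have := integrableB measurableT ig ih; exact.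
  apply: (@le_trans _ _ (\int[nu]_x (M * (1 - tent A x)))).
    apply: le_Rintegral => //.
      by apply: integrable_norm; have := integrableB measurableT ig ih; exact.
    by move=> x _; rewrite distrC.
  rewrite RintegralZl //; last by have := integrableB measurableT i1 it; exact.
  rewrite RintegralB // Rintegral_cst // mul1r ler_wpM2l //.
  rewrite [X in X - _](_ : _ = 1); last exact: (congr1 fine (probability_setT nu)).
  by move: tA; lra.
near=> k.
have sp : \sum_(z : T k) p z = 1 by near: k; exact: p_sum1.
have h1 : `|\sum_(z : T k) p z * g (X z) - \int[nu]_x g x| <= e'.
  by near: k; exact: (hyp _ _ cg g0).
have h2 : `|\sum_(z : T k) p z * tent A (X z) - \int[nu]_x tent A x| <= e'.
  by near: k; exact: (hyp _ _ ct t0).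
have first : `|\sum_(z : T k) p z * h (X z) - \sum_(z : T k) p z * g (X z)| <= M * (2 * e').
  rewrite -sumrB; apply: (le_trans (ler_norm_sum _ _ _)).
  apply: (@le_trans _ _ (\sum_(z : T k) p z * (M * (1 - tent A (X z))))).
    by apply: ler_sum => z _; rewrite -mulrBr normrM ger0_norm // ler_wpM2l.
  have -> : \sum_(z : T k) p z * (M * (1 - tent A (X z))) =
      M * (1 - \sum_(z : T k) p z * tent A (X z)).
    rewrite -[X in X - _]sp -sumrB mulr_sumr; apply: eq_bigr => z _; ring.
  rewrite ler_wpM2l //; move: h2; rewrite ler_norml => /andP[? _].
  by move: tA; lra.
have -> : e = (3 * M + 1) * e' by rewrite /e' mulrC divfK // gt_eqF.
clearbody e'; move: h1 third first; rewrite -[fine _]/(\int[nu]_x h x) /=.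
rewrite !ler_norml => /andP[? ?] /andP[? ?] /andP[? ?]; apply/andP; split; lra.
Unshelve. all: by end_near. Qed.

End Portmanteau.

(** Compare [H] with its convolution by a Gaussian of small variance [v], whose
    expectation tends to the integral of [H] against the density of variance
    [v + s2]; then [v] tends to 0, where the Dirac case [s2 = 0] is the closeness
    of [H] and its convolution at 0. *)
Lemma cvg_in_law_gauss_kernel (R : realType) (T : nat -> finType) (p X : forall k, T k -> R) (s2 : R) :
  0 <= s2 -> (forall k (z : T k), 0 <= p k z) ->
  (\forall k \near \oo, \sum_(z : T k) p k z = 1) ->
  (forall v eta, 0 < v -> 0 < eta -> \forall k \near \oo, forall b,
     `|\sum_(z : T k) p k z * gauss_kernel v (X k z - b) - gauss_kernel (v + s2) b| <= eta) ->
  cvg_in_law p X (normal_law 0 s2).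
Proof.
move=> s20 p0 psum hyp; apply: cvg_in_law_compact_support => // H A cH H0 e e0.
pose I := \int[normal_law 0 s2]_x H x; rewrite -/I.
have [M HM] := compact_support_bounded cH H0.
have M0 : 0 <= M by exact: le_trans (normr_ge0 _) (HM 0).
have mH : measurable_fun setT H by exact: continuous_measurable_fun.
have iH := compact_support_integrable cH H0.
have e3 : 0 < e / 3 by rewrite divr_gt0.
have e6 : 0 < e / 6 by rewrite divr_gt0.
have [d d0 Hd] := compact_support_unif_continuous cH H0 e6.
pose c := 2 * M * (Num.sqrt 2 * (4 / d ^+ 2)).
have c0 : 0 <= c.
  apply: mulr_ge0; first by rewrite mulr_ge0.
  by rewrite mulr_ge0 ?sqrtr_ge0 // divr_ge0 // exprn_ge0 // ltW.
have close v x : 0 < v -> v * (c + 1) <= e / 6 -> `|H x - smooth H v x| <= e / 3.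
  move=> v0 vc; apply: (le_trans (smooth_close mH HM x d0 Hd v0)).
  have -> : 2 * M * (Num.sqrt 2 * (4 * v / d ^+ 2)) = v * c by rewrite /c; ring.
  by move: vc; rewrite mulrDr mulr1; lra.
have c1 : 0 < c + 1 by rewrite ltr_wpDl.
have [v0 v00 v0P] : exists2 v0, 0 < v0 & forall v, 0 < v <= v0 ->
    v * (c + 1) <= e / 6 -> `|smooth H (v + s2) 0 - I| <= e / 3.
  rewrite /I /normal_law; have [s2e|s2ne] := eqVneq s2 0.
    exists 1 => // v /andP[v0 _] vc; rewrite s2e addr0.
    rewrite /Rintegral integral_dirac //=; last exact/measurable_EFinP.
    by rewrite indicT mul1r distrC; exact: close.
  have s2p : 0 < s2 by rewrite lt_neqAle eq_sym s2ne.
  have [v0 v00 vP] := smooth_time mH HM s2p e3 iH.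
  exists v0 => // v vv _; rewrite /Rintegral (integral_normal_prob _ _ mH HM) /=.
  exact: vP.
pose v := Num.min v0 (e / 6 / (c + 1)).
have vp : 0 < v by rewrite lt_min v00 divr_gt0.
have vv0 : 0 < v <= v0 by rewrite vp ge_min lexx.
have vc : v * (c + 1) <= e / 6 by rewrite -ler_pdivlMr // ge_min lexx orbT.
pose L := \int[lebesgue_measure]_b `|H b|.
have L0 : 0 <= L by exact: Rintegral_ge0.
have L1 : 0 < L + 1 by rewrite ltr_wpDl.
pose q := (Num.sqrt (pi *+ 2))^-1 : R.
have q0 : 0 < q by rewrite invr_gt0 sqrtr_gt0 mulrn_wgt0 // pi_gt0.
pose eta := e / 3 / (L + 1).
have eta0 : 0 < eta by rewrite divr_gt0.
near=> k.
have ps : \sum_(z : T k) p k z = 1 by near: k.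
have test : forall b, `|\sum_(z : T k) p k z * gauss_kernel v (X k z - b) - gauss_kernel (v + s2) b| <= eta / q.
  by near: k; apply: hyp => //; rewrite divr_gt0.
have even w x : gauss_kernel w (- x) = gauss_kernel w x :> R by rewrite /gauss_kernel /gauss_mono sqrrN !expr0.
have second : `|\sum_(z : T k) p k z * smooth H v (X k z) - smooth H (v + s2) 0| <= e / 3.
  apply: (@le_trans _ _ (eta * L)).
    apply: (smooth_expectation mH HM) => //; first exact: ltW.
    move=> b; have vs : 0 < v + s2 by rewrite ltr_wpDr.
    have -> : \sum_(z : T k) p k z * normal_pdf (X k z) (Num.sqrt v) b =
        q * \sum_(z : T k) p k z * gauss_kernel v (X k z - b).
      rewrite mulr_sumr; apply: eq_bigr => z _.
      by rewrite normal_pdf_gauss_kernel // -/q -opprB even mulrCA.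
    rewrite normal_pdf_gauss_kernel // -/q subr0 -mulrBr normrM gtr0_norm // mulrC.
    by rewrite -ler_pdivlMr.
  rewrite /eta mulrAC ler_pdivrMr // ler_wpM2l ?(ltW e3) // lerDl //.
have first : `|\sum_(z : T k) p k z * H (X k z) - \sum_(z : T k) p k z * smooth H v (X k z)| <= e / 3.
  rewrite -sumrB; apply: (le_trans (ler_norm_sum _ _ _)).
  apply: (@le_trans _ _ (\sum_(z : T k) p k z * (e / 3))).
    apply: ler_sum => z _; rewrite -mulrBr normrM (ger0_norm (p0 _ _)).
    by apply: ler_wpM2l; [exact: p0|exact: close].
  by rewrite -mulr_suml ps mul1r.
have := v0P v vv0 vc; move: first second.
by rewrite !ler_norml => /andP[? ?] /andP[? ?] /andP[? ?]; apply/andP; split; lra.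
Unshelve. all: by end_near. Qed.

(** * Sums over paths *)

Section PathSums.
Variables (R : realType) (I : finType).

Lemma big_tuple_cons k (F : k.+1.-tuple I -> R) :
  \sum_(x : k.+1.-tuple I) F x = \sum_i \sum_(t : k.-tuple I) F (cons_tuple i t).
Proof.
rewrite pair_big /= (reindex (fun u : I * k.-tuple I => cons_tuple u.1 u.2)) //=.
exists (fun x : k.+1.-tuple I => (thead x, behead_tuple x)) => [[i t] _ | x _] /=.
  by congr (_, _); apply: val_inj.
by case/tupleP: x => i t; apply: val_inj; rewrite /= theadE.
Qed.

Variables (M : I -> I -> R) (w : I -> R).

Fixpoint path_weight i (s : seq I) : R :=
  if s is j :: s' then M i j * path_weight j s' else w i.

(** [path_weight] is the recursive form, along the tail [s] of the path [i :: s],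
    of the weight without its initial factor. *)
Lemma path_weightE i0 i s :
  (\prod_(h < size s) M (nth i0 (i :: s) h) (nth i0 (i :: s) h.+1)) * w (last i s)
  = path_weight i s.
Proof.
elim: s i => [|j s IH] i /=; first by rewrite big_ord0 mul1r.
by rewrite big_ord_recl /= -mulrA -IH.
Qed.

End PathSums.

Lemma iter_transfer_paths (R : realType) n (A : 'M[R]_n.+1) (f : 'I_n.+1 -> R)
    (w : 'cV[R]_n.+1) (h : R -> R) q k s i :
  iter k (transfer A f q) (fun s j => w j 0 * h (s + q * f j)) s i =
  \sum_(t : k.-tuple 'I_n.+1) path_weight A (fun j => w j 0) i t *
     h (s + q * \sum_(j <- i :: t) f j).
Proof.
elim: k s i => [|k IH] s i.
  rewrite (big_pred1 [tuple]) /= => [|t]; first by rewrite big_seq1.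
  by apply/esym/eqP; exact: tuple0.
rewrite iterS /transfer big_tuple_cons; apply: eq_bigr => j _.
rewrite IH mulr_sumr; apply: eq_bigr => t _ /=.
by rewrite mulrA [in RHS]big_cons mulrDr addrA.
Qed.

Lemma iter_transfer_scale (R : realType) n (A : 'M[R]_n.+1) (f : 'I_n.+1 -> R) c q k F s i :
  iter k (transfer (c *: A) f q) F s i = c ^+ k * iter k (transfer A f q) F s i.
Proof.
elim: k s i => [|k IH] s i; first by rewrite mul1r.
rewrite !iterS /transfer mulr_sumr; apply: eq_bigr => j _.
by rewrite IH mxE exprS; ring.
Qed.

Lemma iter_transfer_const (R : realType) n (A : 'M[R]_n.+1) (f : 'I_n.+1 -> R)
    (w : 'cV[R]_n.+1) q k s i :
  iter k (transfer A f q) (fun _ j => w j 0) s i = (A ^+ k *m w) i 0.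
Proof.
elim: k s i => [|k IH] s i; first by rewrite expr0 mul1mx.
rewrite iterS /transfer exprS -mulmxE -mulmxA [RHS]mxE.
by apply: eq_bigr => j _; rewrite IH.
Qed.

(** Tuples that are not paths have weight 0, so the sum runs over all tuples, and
    peeling off the first vertex is one application of the operator. *)
Lemma graph_sum_transfer (R : realType) n (G : cond_weighted_graph R n.+1)
    (f : 'I_n.+1 -> R) (h : R -> R) q k s :
  \sum_(z : gpath G k) weight z * h (s + q * ergodic_sum f z) =
  \sum_i cwg_init G 0 i *
    iter k (transfer (cwg_mat G) f q)
      (fun s j => cwg_final G j 0 * h (s + q * f j)) s i.
Proof.
pose wt (x : k.+1.-tuple 'I_n.+1) :=
  cwg_init G 0 (tnth x ord0)
  * (\prod_(i < k) cwg_mat G (tnth x (inord i)) (tnth x (inord i.+1)))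
  * cwg_final G (tnth x ord_max) 0.
transitivity (\sum_(x : k.+1.-tuple 'I_n.+1) wt x * h (s + q * \sum_(j <- x) f j)).
  rewrite (bigID (@is_path R n.+1 G k)) /= [X in _ + X]big1 ?addr0; last first.
    move=> x; rewrite negb_forall; case/fintype.existsP => i.
    rewrite -leNgt => Mi; have M0 : cwg_mat G (tnth x (inord i)) (tnth x (inord i.+1)) = 0.
      by apply/le_anti; rewrite Mi cwg_mat_ge0.
    by rewrite /wt (bigD1 i) //= M0 mul0r mulr0 !mul0r.
  rewrite (reindex_omap (val : gpath G k -> _) insub) /=; last first.
    by move=> x xp; rewrite insubT.
  apply: eq_big => [z|z _]; first by rewrite valK eqxx (valP z).
  congr (_ * h (s + q * _)); rewrite /ergodic_sum /vertex.
  by rewrite big_tuple.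
rewrite big_tuple_cons; apply: eq_bigr => i _; rewrite iter_transfer_paths mulr_sumr.
apply: eq_bigr => t _; rewrite mulrA; congr (_ * _).
rewrite /wt -mulrA; congr (cwg_init G 0 _ * _).
rewrite -(path_weightE _ _ i) size_tuple; congr (_ * cwg_final G _ 0).
  apply: eq_bigr => j _; rewrite !(tnth_nth i) /= !inordK ?ltnS //.
  exact: ltnW.
by rewrite (tnth_nth i) (last_nth i) size_tuple.
Qed.

(** * The asymptotic variance *)

Section EdgeForm.
Variables (R : realType) (I : finType) (e : I -> I -> R) (pi : I -> R).
Hypotheses (e_ge0 : forall i j, 0 <= e i j)
  (e_row : forall i, \sum_j e i j = pi i) (e_col : forall j, \sum_i e i j = pi j).

Lemma edge_form (f g : I -> R) :
  (forall i, \sum_j e i j * g j = pi i * (g i - f i)) ->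
  \sum_i \sum_j e i j * (f i + g j - g i) ^+ 2 = \sum_i pi i * (2 * f i * g i - f i ^+ 2).
Proof.
move=> hg.
have -> : \sum_i \sum_j e i j * (f i + g j - g i) ^+ 2 =
    \sum_i (\sum_j e i j * (f i - g i) ^+ 2 + \sum_j e i j * g j * (2 * (f i - g i))
       + \sum_j e i j * g j ^+ 2).
  apply: eq_bigr => i _; rewrite -!big_split /=; apply: eq_bigr => j _; ring.
rewrite !big_split /= [X in _ + X]exchange_big /=.
have -> : \sum_j \sum_i e i j * g j ^+ 2 = \sum_i pi i * g i ^+ 2.
  by apply: eq_bigr => j _; rewrite -mulr_suml e_col.
rewrite -!big_split /=; apply: eq_bigr => i _.
rewrite -!mulr_suml e_row hg; ring.
Qed.

Lemma edge_form_ge0 (f g : I -> R) : 0 <= \sum_i \sum_j e i j * (f i + g j - g i) ^+ 2.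
Proof. by apply: sumr_ge0 => i _; apply: sumr_ge0 => j _; rewrite mulr_ge0 ?sqr_ge0. Qed.

(** If [f i = g' i - g' j] along the edges, then [d = g - g'] satisfies
    [sum_j e i j d j = pi i d i], and [edge_form] with [f := 0] shows that the sum
    of the [e i j (d j - d i)^2], to which the edge form reduces, vanishes. *)
Lemma edge_form_eq0 (f g : I -> R) :
  (forall i, \sum_j e i j * g j = pi i * (g i - f i)) ->
  \sum_i \sum_j e i j * (f i + g j - g i) ^+ 2 = 0 <->
  exists g', forall i j, e i j != 0 -> f i = g' i - g' j.
Proof.
move=> hg; split => [|[g' hg']].
  move=> /eqP; rewrite psumr_eq0 => [/allP h|i _]; last first.
    by apply: sumr_ge0 => j _; rewrite mulr_ge0 ?sqr_ge0.
  exists g => i j eij; have := h i; rewrite mem_index_enum => /(_ isT) /=.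
  rewrite psumr_eq0 => [/allP /(_ j)|j' _]; last by rewrite mulr_ge0 ?sqr_ge0.
  rewrite mem_index_enum => /(_ isT) /=; rewrite mulf_eq0 (negPf eij) /= sqrf_eq0.
  by move=> /eqP h0; lra.
pose d i := g i - g' i.
have ed i j : e i j * (f i + g j - g i) = e i j * (0 + d j - d i).
  have [->|eij] := eqVneq (e i j) 0; first by rewrite !mul0r.
  by rewrite (hg' _ _ eij) /d; ring.
have -> : \sum_i \sum_j e i j * (f i + g j - g i) ^+ 2 =
    \sum_i \sum_j e i j * ((fun=> 0) i + d j - d i) ^+ 2.
  apply: eq_bigr => i _; apply: eq_bigr => j _.
  have [->|eij] := eqVneq (e i j) 0; first by rewrite !mul0r.
  by rewrite (hg' _ _ eij) /d; congr (_ * _ ^+ 2); ring.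
rewrite edge_form; first by apply: big1 => i _; ring.
move=> i; rewrite subr0.
have : \sum_j e i j * (f i + g j - g i) = \sum_j e i j * (0 + d j - d i).
  by apply: eq_bigr => j _; exact: ed.
have lin x y (u : I -> R) : \sum_j e i j * (x + u j - y) =
    pi i * (x - y) + \sum_j e i j * u j.
  rewrite -e_row mulr_suml -big_split /=; apply: eq_bigr => j _; ring.
rewrite !lin hg => h; apply/eqP; rewrite -subr_eq0; apply/eqP.
by transitivity (pi i * (0 - d i) + \sum_j e i j * d j); [ring|rewrite -h; ring].
Qed.

End EdgeForm.

Section Correctors.
Variables (R : realType) (n : nat) (A : 'M[R]_n.+1) (f : 'I_n.+1 -> R).
Variables (l : 'rV[R]_n.+1) (r : 'cV[R]_n.+1).
Hypothesis A0 : forall i j, 0 <= A i j.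
Hypotheses (l0 : forall i, 0 <= l 0 i) (r0 : forall i, 0 <= r i 0).
Hypotheses (Ar : A *m r = r) (lA : l *m A = l) (lr1 : (l *m r) 0 0 = 1).
Hypothesis powA : forall i j, (fun k => (A ^+ k) i j) @ \oo --> (r i 0 * l 0 j).

(** The zeros of [r] form a set that [A] does not leave, and on which [a] is a
    fixed point of [A]; there it equals the limit [r i * (l a) = 0] of its
    iterates. So [a] can be divided by [r]. *)
Lemma corrector_vanishes (a : 'cV[R]_n.+1) i :
  (forall i, a i 0 = f i * r i 0 + (A *m a) i 0) -> (l *m a) 0 0 = 0 ->
  r i 0 = 0 -> a i 0 = 0.
Proof.
move=> aE la ri0.
have powa k : forall i, r i 0 = 0 -> (A ^+ k *m a) i 0 = a i 0.
  elim: k => [|k IH] {ri0}i ri0; first by rewrite expr0 mul1mx.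
  rewrite exprS -mulmxE -mulmxA mxE [RHS]aE ri0 mulr0 add0r mxE.
  apply: eq_bigr => j _.
  have : A i j * r j 0 = 0.
    apply/eqP; move: (congr1 (fun v : 'cV[R]_n.+1 => v i 0) Ar) => /eqP.
    rewrite ri0 mxE psumr_eq0 => [/allP /(_ j)|j' _]; last by rewrite mulr_ge0.
    by rewrite mem_index_enum => /(_ isT).
  move=> /eqP; rewrite mulf_eq0 => /orP[/eqP ->|/eqP /IH ->//]; by rewrite !mul0r.
have := @power_vec_cvg _ _ _ _ _ powA a i; rewrite la mulr0.
under eq_fun do rewrite powa //.
by move=> /cvg_lim <- //; rewrite lim_cst.
Qed.

(** [b] exists when [l] kills its source term, which determines [s2]; the edge form
    with [g = a / r] rewrites this value as a sum of squares. *)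
Lemma correctors_exist : \sum_i l 0 i * f i * r i 0 = 0 ->
  exists (a b : 'cV[R]_n.+1) (s2 : R),
  [/\ 0 <= s2,
      forall i, a i 0 = f i * r i 0 + (A *m a) i 0,
      forall i, b i 0 = (A *m b) i 0 + 2^-1 * f i ^+ 2 * r i 0
        + f i * (A *m a) i 0 - 2^-1 * s2 * r i 0
    & s2 = 0 <-> exists g, forall i j, l 0 i * A i j * r j 0 != 0 -> f i = g i - g j].
Proof.
move=> lfr.
pose y := \col_i (f i * r i 0).
have ly : (l *m y) 0 0 = 0.
  by rewrite mxE -[RHS]lfr; apply: eq_bigr => i _; rewrite mxE mulrA.
have [a aE' la] := poisson_solvable lA lr1 powA ly.
have aE i : a i 0 = f i * r i 0 + (A *m a) i 0.
  by rewrite {1}aE' mxE; congr (_ + _); rewrite mxE.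
pose e i j := l 0 i * A i j * r j 0.
pose pi i := l 0 i * r i 0.
have e_ge0 i j : 0 <= e i j by rewrite /e !mulr_ge0.
have e_row i : \sum_j e i j = pi i.
  rewrite /pi -[in RHS]Ar mxE mulr_sumr; apply: eq_bigr => j _; by rewrite mulrA.
have e_col j : \sum_i e i j = pi j.
  by rewrite /pi -[in RHS]lA mxE mulr_suml.
pose g i := a i 0 / r i 0.
have rg i : r i 0 * g i = a i 0.
  have [ri|ri] := eqVneq (r i 0) 0; first by rewrite ri mul0r (corrector_vanishes aE la ri).
  by rewrite /g mulrC divfK.
have eg i : \sum_j e i j * g j = l 0 i * (A *m a) i 0.
  rewrite mxE mulr_sumr; apply: eq_bigr => j _.
  by rewrite /e -mulrA rg mulrA.
have hg i : \sum_j e i j * g j = pi i * (g i - f i).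
  rewrite eg /pi mulrBr -mulrA rg -mulrA [r i 0 * f i]mulrC -mulrBr; congr (_ * _).
  by rewrite [a i 0]aE; ring.
pose s2 := \sum_i \sum_j e i j * (f i + g j - g i) ^+ 2.
have s2E : s2 = \sum_i l 0 i * (f i ^+ 2 * r i 0 + 2 * (f i * (A *m a) i 0)).
  rewrite /s2 (edge_form e_row e_col hg); apply: eq_bigr => i _.
  rewrite [l 0 i * (_ + _)]mulrDr.
  have -> : l 0 i * (2 * (f i * (A *m a) i 0)) = 2 * f i * (l 0 i * (A *m a) i 0) by ring.
  rewrite -eg hg /pi; ring.
have s2_ge0 : 0 <= s2 by exact: edge_form_ge0.
have s2P := edge_form_eq0 e_ge0 e_row e_col hg; rewrite -/s2 in s2P.
clearbody s2.
pose y2 := \col_i (2^-1 * f i ^+ 2 * r i 0 + f i * (A *m a) i 0 - 2^-1 * s2 * r i 0).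
have ly2 : (l *m y2) 0 0 = 0.
  rewrite mxE; transitivity (2^-1 * s2 - 2^-1 * s2 * (l *m r) 0 0); last first.
    by rewrite lr1 mulr1 subrr.
  rewrite {1}s2E [(l *m r) 0 0]mxE !mulr_sumr -sumrB; apply: eq_bigr => i _.
  by rewrite [y2 i 0]mxE; field.
have [b bE' _] := poisson_solvable lA lr1 powA ly2.
exists a, b, s2; split => //.
by move=> i; rewrite {1}bE' mxE [y2 i 0]mxE; ring.
Qed.

End Correctors.

(** * The central limit theorem *)

(** Numerator and denominator of the expectation are both [lam ^+ k] times sums
    that converge, the denominator to a positive limit. *)
Lemma gaussian_test_cvg (R : realType) n (G : cond_weighted_graph R n.+1)
    (A : 'M[R]_n.+1) (lam : R) (l : 'rV[R]_n.+1) (r : 'cV[R]_n.+1)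
    (f : 'I_n.+1 -> R) (a b : 'cV[R]_n.+1) (s2 : R) :
  0 < lam -> cwg_mat G = lam *: A ->
  A *m r = r -> l *m A = l -> (l *m r) 0 0 = 1 ->
  (forall i j, (fun k => (A ^+ k) i j) @ \oo --> (r i 0 * l 0 j)) ->
  0 < (cwg_init G *m r) 0 0 * (l *m cwg_final G) 0 0 ->
  0 <= s2 ->
  (forall i, a i 0 = f i * r i 0 + (A *m a) i 0) ->
  (forall i, b i 0 = (A *m b) i 0 + 2^-1 * f i ^+ 2 * r i 0
        + f i * (A *m a) i 0 - 2^-1 * s2 * r i 0) ->
  (\forall k \near \oo, \sum_(z : gpath G k) weighted_distr z = 1) /\
  (forall v eta, 0 < v -> 0 < eta -> \forall k \near \oo, forall x,
     `|\sum_(z : gpath G k) weighted_distr z *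
         gauss_kernel v ((Num.sqrt k.+1%:R)^-1 * ergodic_sum f z - x) - gauss_kernel (v + s2) x| <= eta).
Proof.
move=> lam0 GA Ar lA lr1 powA; set w := cwg_final G; set c := _ * _ => c0 s20 aE bE.
have A0 i j : 0 <= A i j.
  by have := cwg_mat_ge0 G i j; rewrite GA mxE pmulr_rge0.
have lamk k : 0 < lam ^+ k by rewrite exprn_gt0.
pose Z k := \sum_i cwg_init G 0 i * (A ^+ k *m w) i 0.
have ZE k : partition_sum G k = lam ^+ k * Z k.
  have := graph_sum_transfer G (fun=> 0) (fun=> 1) 0 k 0.
  under eq_bigr do rewrite mulr1.
  rewrite -/(partition_sum G k) => ->; rewrite GA /Z mulr_sumr; apply: eq_bigr => i _.
  rewrite iter_transfer_scale mulrCA; congr (_ * (_ * _)).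
  rewrite -(iter_transfer_const A (fun=> 0) w 0 k 0 i); congr (iter k _ _ 0 i).
  by apply/funext => x; apply/funext => j; rewrite mulr1.
have Zc : Z @ \oo --> c.
  have -> : c = \sum_i cwg_init G 0 i * (r i 0 * (l *m w) 0 0).
    by rewrite /c [(cwg_init G *m r) 0 0]mxE mulr_suml; apply: eq_bigr => i _; rewrite mulrA.
  apply: (@cvg_sum_seq _ _ _ (fun i k => cwg_init G 0 i * (A ^+ k *m w) i 0)) => i.
  by apply: cvgM; [exact: cvg_cst | exact: power_vec_cvg].
have c20 : 0 < c / 2 by rewrite divr_gt0.
have Z2 : \forall k \near \oo, c / 2 <= Z k.
  move/cvgrPdist_le : Zc => /(_ _ c20); apply: filterS => k.
  by rewrite ler_norml => /andP[_]; lra.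
split.
  apply: filterS Z2 => k Zk; rewrite /weighted_distr -mulr_suml -/(partition_sum G k).
  by rewrite divff // ZE mulf_neq0 ?gt_eqF // (lt_le_trans c20).
move=> v eta v0 eta0.
have [K K0 fb] := gauss_kernel_bounds (v + s2) v0.
pose W := \sum_i `|cwg_init G 0 i|.
have W0 : 0 <= W by apply: sumr_ge0.
have WK1 : 0 < W + K + 1 by rewrite ltr_wpDl // addr_ge0.
pose del := eta * (c / 2) / (W + K + 1).
have del0 : 0 < del by rewrite divr_gt0 // mulr_gt0.
have [k0 hk0] := transfer_limit A0 Ar lr1 powA s20 aE bE fb K0 w del0.
have Zd : \forall k \near \oo, `|c - Z k| <= del by move/cvgrPdist_le : Zc; exact.
near=> k => x.
have Zk : c / 2 <= Z k by near: k.
have Zk0 : 0 < Z k by exact: lt_le_trans Zk.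
have Zkd : `|c - Z k| <= del by near: k.
have /hk0 {}hk0 : (k0 <= k)%N by near: k; exists k0.
set q := (Num.sqrt _)^-1 in hk0 *.
pose Num := \sum_i cwg_init G 0 i *
  iter k (transfer A f q) (fun s j => w j 0 * gauss_kernel v (s + q * f j)) (- x) i.
have even u y : gauss_kernel u (- y) = gauss_kernel u y :> R by rewrite /gauss_kernel /gauss_mono sqrrN !expr0.
have -> : \sum_(z : gpath G k) weighted_distr z * gauss_kernel v (q * ergodic_sum f z - x) = Num / Z k.
  under eq_bigr do rewrite /weighted_distr mulrAC addrC.
  rewrite -mulr_suml graph_sum_transfer ZE GA.
  have -> : \sum_i cwg_init G 0 i * iter k (transfer (lam *: A) f q)
      (fun s j => w j 0 * gauss_kernel v (s + q * f j)) (- x) i = lam ^+ k * Num.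
    by rewrite mulr_sumr; apply: eq_bigr => i _; rewrite iter_transfer_scale mulrCA.
  by rewrite invfM mulrACA divff ?mul1r // gt_eqF.
set g := gauss_kernel (v + s2) x.
have gK : `|g| <= K by apply: (flow_bound fb); rewrite lexx lerDl s20.
have NumP : `|Num - c * g| <= W * del.
  have -> : c * g = \sum_i cwg_init G 0 i * (r i 0 * (l *m w) 0 0 * g).
    rewrite /c [(cwg_init G *m r) 0 0]mxE !mulr_suml; apply: eq_bigr => i _.
    by rewrite !mulrA.
  rewrite -sumrB; apply: (le_trans (ler_norm_sum _ _ _)); rewrite mulr_suml.
  apply: ler_sum => i _; rewrite -mulrBr normrM ler_wpM2l //.
  by rewrite /g -even; exact: hk0.
have -> : Num / Z k - g = ((Num - c * g) + g * (c - Z k)) / Z k.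
  by field; rewrite gt_eqF.
rewrite normrM normfV (gtr0_norm Zk0) ler_pdivrMr //.
apply: (le_trans (ler_normD _ _)); rewrite normrM.
apply: (@le_trans _ _ (W * del + K * del)).
  by apply: lerD => //; apply: ler_pM.
apply: (@le_trans _ _ (eta * (c / 2))); last by rewrite ler_wpM2l // ltW.
rewrite -mulrDl /del mulrA ler_pdivrMr // mulrC ler_wpM2l ?lerDl //.
by rewrite mulr_ge0 // ltW.
Unshelve. all: by end_near. Qed.

Unset Implicit Arguments.

Theorem theorem5p2 (R : realType) (N : nat) (G : cond_weighted_graph R N)
    (p : 'I_N -> R) (hp : stationary_measure G p) (f : 'I_N -> R) :
  let gamma := \sum_(j < N) p j * f j in
  exists s2 : R,
    [/\ 0 <= s2,
        cvg_in_law (@weighted_distr R N G)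
          (fun k z => (ergodic_sum f z - k.+1%:R * gamma) / Num.sqrt k.+1%:R)
          (normal_law 0 s2)
      & s2 = 0 <->
        exists g : 'I_N -> R, forall i j : 'I_N,
          0 < cwg_mat G i j -> p i != 0 -> p j != 0 ->
          f i = gamma + g i - g j].
Proof.
move=> gamma; have N1 := cwg_order G.
case: N N1 G p hp f @gamma => [//|[//|n]] _ G p [lam [l [r [Dlam Plr pE]]]] f gamma.
have [lam0 [lamE lam00 Mr lM powA]] := perron_power_cvg (cwg_mat_ge0 G) Dlam Plr.
have [lam' [l' [r' [Dlam' Plr' init_gt0 final_gt0]]]] := cwg_perron G.
have lamlam' : lam' = lam.
  case: Dlam Dlam' => [E1 D1 _] [E2 D2 _]; apply/eqP/negPn/negP => ne.
  have := D1 _ E2 ne; have := D2 _ E1; rewrite eq_sym => /(_ ne).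
  by move=> /lt_trans /[apply]; rewrite ltxx.
subst lam'.
have [lam0' [lamE' _ _ _ powA']] := perron_power_cvg (cwg_mat_ge0 G) Dlam' Plr'.
have lam0E : lam0' = lam0 by apply: (@complexI R); rewrite -lamE' -lamE.
subst lam0'.
have rl i j : r' i 0 * l' 0 j = r i 0 * l 0 j.
  by apply: (cvg_unique _ (powA' i j) (powA i j)).
pose A := lam0^-1 *: cwg_mat G.
have lam0ne : lam0 != 0 by rewrite gt_eqF.
have GA : cwg_mat G = lam0 *: A by rewrite scalerA divff // scale1r.
have Ar : A *m r = r by rewrite -scalemxAl Mr scalerA mulVf // scale1r.
have lA : l *m A = l by rewrite -scalemxAr lM scalerA mulVf // scale1r.
have lr1 := left_right1 Plr.
have A0 i j : 0 <= A i j by rewrite mxE mulr_ge0 ?invr_ge0 ?(ltW lam00) // cwg_mat_ge0.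
have c_gt0 : 0 < (cwg_init G *m r) 0 0 * (l *m cwg_final G) 0 0.
  suff -> : (cwg_init G *m r) 0 0 * (l *m cwg_final G) 0 0 =
      (cwg_init G *m r') 0 0 * (l' *m cwg_final G) 0 0 by rewrite mulr_gt0.
  rewrite !mxE !mulr_suml; apply: eq_bigr => i _; rewrite !mulr_sumr.
  apply: eq_bigr => j _; rewrite -!mulrA; congr (_ * _).
  by rewrite !mulrA rl.
pose fc i := f i - gamma.
have centred : \sum_i l 0 i * fc i * r i 0 = 0.
  have sp : \sum_i p i = 1.
    by rewrite -lr1 mxE; apply: eq_bigr => i _; rewrite pE.
  transitivity (\sum_i (p i * f i - p i * gamma)).
    by apply: eq_bigr => i _; rewrite /fc pE; ring.
  by rewrite sumrB -mulr_suml sp mul1r /gamma subrr.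
have [a [b [s2 [s20 aE bE s2P]]]] := correctors_exist A0 (left_ge0 Plr) (right_ge0 Plr)
  Ar lA lr1 powA centred.
have [dist1 test] := gaussian_test_cvg lam00 GA Ar lA lr1 powA c_gt0 s20 aE bE.
exists s2; split => //.
- apply: cvg_in_law_gauss_kernel => //.
    have weight_ge0 k (z : gpath G k) : 0 <= weight z.
      rewrite /weight !mulr_ge0 ?cwg_init_ge0 ?cwg_final_ge0 //.
      by apply: prodr_ge0 => i _; exact: cwg_mat_ge0.
    by move=> k z; rewrite divr_ge0 ?weight_ge0 // sumr_ge0.
  move=> v eta v0 eta0; have := test v eta v0 eta0.
  apply: filterS => k h x.
  have := h x; congr (`|_ - _| <= _); apply: eq_bigr => z _; congr (_ * gauss_kernel v (_ - x)).
  rewrite mulrC; congr (_ * _); rewrite /ergodic_sum sumrB; congr (_ - _).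
  by rewrite sumr_const card_ord mulr_natl.
- have ePi i j : (l 0 i * A i j * r j 0 != 0) = [&& 0 < cwg_mat G i j, p i != 0 & p j != 0].
    have lp := left_ge0 Plr; have rp := right_ge0 Plr.
    have Mp : (0 < cwg_mat G i j) = (A i j != 0).
      by rewrite GA mxE pmulr_rgt0 // lt_neqAle A0 andbT eq_sym.
    rewrite Mp !pE !mulf_eq0 !negb_or.
    have [/= Aij|_] := boolP (A i j != 0); last by rewrite andbF.
    have [li|li] := eqVneq (l 0 i) 0; first by [].
    have [rj|rj] := eqVneq (r j 0) 0; first by rewrite /= !andbF.
    have ri : r i 0 != 0.
      rewrite gt_eqF // -[r]Ar mxE (bigD1 j) //= ltr_wpDr ?sumr_ge0 // => [j' _|].
        by rewrite mulr_ge0.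
      by rewrite mulr_gt0 // lt_neqAle eq_sym ?Aij ?rj ?A0 ?rp.
    have lj : l 0 j != 0.
      rewrite gt_eqF // -[l]lA mxE (bigD1 i) //= ltr_wpDr ?sumr_ge0 // => [j' _|].
        by rewrite mulr_ge0.
      by rewrite mulr_gt0 // lt_neqAle eq_sym ?Aij ?li ?A0 ?lp.
    by rewrite ri lj.
  rewrite s2P; split => [[g hg]|[g hg]]; exists g => i j.
    move=> Mij pi pj; have : l 0 i * A i j * r j 0 != 0 by rewrite ePi Mij pi pj.
    by move=> /hg; rewrite /fc; lra.
  by rewrite ePi => /and3P[Mij pi pj]; rewrite /fc (hg i j Mij pi pj); ring.
Qed.
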